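(* For all positive integers $n,k$ there is a constant $M=M(n,k)$ such that the following holds. Let $G$ be a group (finite or infinite) satisfying the commutator covering condition with parameters $n$ and $S$, where $S\subseteq G'$ is a finite set with $|S|=k$. Then $G$ has a subgroup $H$, nilpotent of class at most $4$, such that $[G:H]$ and $|\gamma_4(H)|$ are both finite and at most $M$.
   Context: Let $G$ be a group. For subsets $X,Y\subseteq G$, $\mathrm{Comm}(X,Y)$ denotes the set of commutators $\{[x,y]:x\in X,\,y\in Y\}$, where $[x,y]=x^{-1}y^{-1}xy$. $x^G$ is the conjugacy class of $x$ in $G$. For a positive integer $n$ and $S\subseteq G'=[G,G]$, put $B=\{x\in G:|x^G|\leq n\}$. $G$ satisfies the commutator covering condition with parameters $n$ and $S$ if $\mathrm{Comm}(G,G)\subseteq BS=\{bs:b\in B,s\in S\}$. $\gamma_i$ denotes the $i$-th term of the lower central series, with $\gamma_1(H)=H$. *)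

(* Defs.v *)
From mathcomp Require Import all_boot.
From mathcomp Require Import boolp classical_sets functions cardinality.

Set Implicit Arguments.
Unset Strict Implicit.
Unset Printing Implicit Defensive.

Local Open Scope group_scope.
Local Open Scope classical_set_scope.
Local Open Scope card_scope.

(* The classical set [H] is turned into the collective predicate expected by
   [group_closed] (contains 1 and is closed under [x / y]). *)
Definition is_subgroup (G : groupType) (H : set G) : Prop :=
  group_closed (mem H).

Definition generated (G : groupType) (A : set G) : set G :=
  smallest (@is_subgroup G) A.

(* [[~ x, y]] unfolds to [x^-1 * (y^-1 * (x * y))]. *)
Definition Comm (G : groupType) (X Y : set G) : set G :=
  [set [~ x, y] | x in X & y in Y].

Definition commutator_subgroup (G : groupType) (X Y : set G) : set G :=
  generated (Comm X Y).

Definition conj_class (G : groupType) (x : G) : set G :=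
  [set x ^ g | g in [set: G]].

Definition small_classes (G : groupType) (n : nat) : set G :=
  [set x | conj_class x #<= `I_n].

Definition comm_covering (G : groupType) (n : nat) (S : set G) : Prop :=
  Comm [set: G] [set: G] `<=` [set b * s | b in @small_classes G n & s in S].

(* Indexed from 1, so that [lower_central 1 H] is [H]; the value at 0 is also
   [H], as for ['L_0(H)] in the library of finite groups. *)
Definition lower_central (G : groupType) (i : nat) (H : set G) : set G :=
  iter i.-1 (fun K => commutator_subgroup K H) H.

Definition nilpotent_class_le (G : groupType) (c : nat) (H : set G) : Prop :=
  lower_central c.+1 H = [set 1].

Definition right_cosets (G : groupType) (H : set G) : set (set G) :=
  [set [set h * g | h in H] | g in [set: G]].

(* Main.v *)
Require Import Defs.
From HB Require Import structures.
From mathcomp Require Import all_boot.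
From mathcomp Require Import boolp classical_sets functions cardinality.

Set Implicit Arguments.
Unset Strict Implicit.
Unset Printing Implicit Defensive.

Local Open Scope group_scope.
Local Open Scope classical_set_scope.
Local Open Scope card_scope.

(* Let B_N be the set of elements with at most N conjugates. Merging the elements
   of S that lie in few cosets of B with 1 produces an N and a gap: products of
   two commutators that have class size at most a large function of N already
   lie in B = B_N. Then {y | [x, y] in B} is a subgroup of bounded index for all
   x, and Neumann's argument, applied to a product of two commutators in B whose
   class under <B> is as large as possible, yields a subgroup V of bounded index
   and a bounded normal subgroup P such that V' centralizes B modulo P. As
   commutators of V are determined modulo B by finitely many of them, V'' is then
   bounded modulo P.

   This reduces to the metabelian case, where for fixed x, z the set
   {y | [x, y, z] = 1} is a subgroup. B. H. Neumann's covering lemma shows that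
   its index is bounded for all z in a subgroup Z_x of bounded index. The Jacobi
   identity makes this relation between x and z symmetric. Choosing x such that
   the number of pairwise independent z is maximal, one finds a subgroup H of
   bounded index such that {y | [u, y, z, t] = 1} has bounded index for all
   u, z, t in H. The same then holds for the three other variables, and a
   multilinear form of Neumann's argument bounds gamma_4. *)

(** The obstacle is that [small N] is not closed under products. The gap repairs this where it
    matters: an element of [comm2] that happens to be a product of at most eight elements of
    [small N] is itself in [small N]. Two commutators are taken because the quotients [[~ x, y] /
    [~ x', y']] and the triple commutators [[~ x, y, z]] are of this form. The class under <B>,
    rather than under [G], is maximized because the conjugating elements can then be short words in
    B, so that their own centralizers have bounded index. Generated subgroups are bounded by
    shortening words, which asks for no torsion of the letters, only that [c ^+ q.+1] is a product
    of [q] letters. Passing to the section squares [n], so the metabelian case starts from new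
    parameters and makes its own gap. Class 4 comes at the very end: a bounded gamma_4 has a
    centralizer of bounded index, on which gamma_5 vanishes. As [G] may be infinite, bounds are
    expressed by colourings, which combine by taking tuples of colours. *)

Ltac gnormalize := rewrite /commg /conjg ?gnorm.

(** * Relations with boundedly many classes *)

Section ClassesLe.
Variable X : Type.
Implicit Types (A : set X) (E : X -> X -> Prop) (n m : nat).

(* [E] need not be an equivalence: all that is asked is a colouring of [A] with
   [n] colours whose monochromatic pairs are [E]-related. *)
Definition classes_le A E n :=
  exists f : X -> 'I_n, forall x y, A x -> A y -> f x = f y -> E x y.

Lemma classes_le_intro (T : finType) (f : X -> T) A E n : #|T| <= n ->
  (forall x y, A x -> A y -> f x = f y -> E x y) -> classes_le A E n.
Proof.
move=> Tn fE; exists (fun x => widen_ord Tn (enum_rank (f x))) => x y Ax Ay.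
by move=> /(congr1 val)/= /val_inj/enum_rank_inj; exact: fE.
Qed.

Lemma classes_le_sub A A' E E' n n' : classes_le A E n -> A' `<=` A ->
  (forall x y, A' x -> A' y -> E x y -> E' x y) -> n <= n' ->
  classes_le A' E' n'.
Proof.
move=> [f fE] sA sE nn'; apply: (@classes_le_intro _ f).
  by rewrite card_ord.
by move=> x y Ax Ay /fE; move=> /(_ (sA _ Ax) (sA _ Ay)); exact: sE.
Qed.

Lemma classes_leI A E E' n m : classes_le A E n -> classes_le A E' m ->
  classes_le A (fun x y => E x y /\ E' x y) (n * m).
Proof.
move=> [f fE] [g gE]; apply: (@classes_le_intro _ (fun x => (f x, g x))).
  by rewrite card_prod !card_ord.
by move=> x y Ax Ay [? ?]; split; [exact: fE|exact: gE].
Qed.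

Lemma classes_le_forall (T : finType) A (E : T -> X -> X -> Prop) n :
  (forall t, classes_le A (E t) n) ->
  classes_le A (fun x y => forall t, E t x y) (n ^ #|T|).
Proof.
move=> /choice[f fE].
apply: (@classes_le_intro _ (fun x => [ffun t => f t x])).
  by rewrite card_ffun !card_ord.
by move=> x y Ax Ay /ffunP e t; apply: fE => //; have := e t; rewrite !ffunE.
Qed.

Lemma classes_le_pigeonhole A E n (x : nat -> X) : classes_le A E n ->
  (forall i, A (x i)) ->
  exists i j, [/\ i < j, j <= n, E (x i) (x j) & E (x j) (x i)].
Proof.
move=> [f fE] Ax.
have /injectivePn[i [j ij fij]] : ~~ injectiveb (fun i : 'I_n.+1 => f (x i)).
  apply/negP => /injectiveP/leq_card; rewrite !card_ord; by rewrite ltnn.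
wlog ltij : i j ij fij / i < j.
  move=> W; case: (ltngtP i j) => [|ji|/val_inj e]; first exact: W.
    by apply: (W j i) => //; rewrite eq_sym.
  by rewrite e eqxx in ij.
exists i, j; split => //; first by rewrite -ltnS.
  exact: fE.
exact: fE.
Qed.

End ClassesLe.

Lemma classes_le_preim X Y (h : Y -> X) (A : set X) E n : classes_le A E n ->
  classes_le (h @^-1` A) (fun x y => E (h x) (h y)) n.
Proof. by move=> [f fE]; exists (f \o h) => x y; exact: fE. Qed.

Lemma card_le_classes_le X (A : set X) n : A !=set0 ->
  A #<= `I_n -> classes_le A (fun x y => x = y) n.
Proof.
move=> [a Aa] /pcard_leP[f].
have fA x : A x -> f x < n by move=> /(@funS _ _ A `I_n f).
have n0 : 0 < n by exact: leq_ltn_trans (fA _ Aa).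
exists (fun x => if pselect (A x) is left Ax then Ordinal (fA _ Ax)
                 else Ordinal n0) => x y Ax Ay.
case: pselect => // Ax'; case: pselect => // Ay' -[fxy].
by apply: (@inj _ _ _ f) => //; rewrite inE.
Qed.

Lemma classes_le_card_le X (A : set X) n :
  classes_le A (fun x y => x = y) n -> A #<= `I_n.
Proof.
move=> [f fE]; have finj : {in A &, injective (fun x => val (f x))}.
  by move=> x y; rewrite !inE => Ax Ay /val_inj; exact: fE.
rewrite -(card_le_eql (inj_card_eq finj)); apply: subset_card_le.
by move=> _ [x _ <-] /=.
Qed.

(** * Subgroups and their index *)

Section Subgroups.
Variable G : groupType.
Implicit Types (H K A : set G) (a x y z g h : G) (n m : nat).

Lemma subgroupP H :
  is_subgroup H <-> H 1 /\ forall x y, H x -> H y -> H (x / y).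
Proof.
split=> [[H1 HF]|[H1 HF]]; split.
- by move: H1; rewrite inE.
- by move=> x y Hx Hy; have := HF x y; rewrite !inE; exact.
- by rewrite inE.
- by move=> x y; rewrite !inE; exact: HF.
Qed.

Lemma subgroup1 H : is_subgroup H -> H 1.
Proof. by move=> /subgroupP[]. Qed.

Lemma subgroupF H x y : is_subgroup H -> H x -> H y -> H (x / y).
Proof. by move=> /subgroupP[_]; exact. Qed.

Lemma subgroupV H x : is_subgroup H -> H x -> H x^-1.
Proof. by move=> sH Hx; rewrite -div1g; exact: (subgroupF sH (subgroup1 sH) Hx). Qed.

Lemma subgroupM H x y : is_subgroup H -> H x -> H y -> H (x * y).
Proof.
by move=> sH Hx Hy; rewrite -[y]invgK; exact: (subgroupF sH Hx (subgroupV sH Hy)).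
Qed.

Lemma subgroupJ H x y : is_subgroup H -> H x -> H y -> H (x ^ y).
Proof.
by move=> sH Hx Hy; exact: (subgroupM sH (subgroupV sH Hy) (subgroupM sH Hx Hy)).
Qed.

Lemma subgroupR H x y : is_subgroup H -> H x -> H y -> H [~ x, y].
Proof.
by move=> sH Hx Hy; exact: (subgroupM sH (subgroupV sH Hx) (subgroupJ sH Hx Hy)).
Qed.

Lemma subgroup_intro H : H 1 -> (forall x y, H x -> H y -> H (x * y)) ->
  (forall x, H x -> H x^-1) -> is_subgroup H.
Proof. by move=> H1 HM HV; apply/subgroupP; split=> // x y Hx /HV; exact: HM. Qed.

Lemma subgroupI H K : is_subgroup H -> is_subgroup K -> is_subgroup (H `&` K).
Proof.
move=> sH sK; apply/subgroupP; split; first by split; exact: subgroup1.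
by move=> x y [Hx Kx] [Hy Ky]; split; exact: subgroupF.
Qed.

Lemma subgroup_bigI (I : Type) (P : set I) (F : I -> set G) :
  (forall i, P i -> is_subgroup (F i)) ->
  is_subgroup [set g | forall i, P i -> F i g].
Proof.
move=> sF; apply/subgroupP; split=> [i Pi|x y Fx Fy i Pi].
  exact: (subgroup1 (sF _ Pi)).
exact: (subgroupF (sF _ Pi) (Fx _ Pi) (Fy _ Pi)).
Qed.

Lemma subgroup_cent A : is_subgroup [set g | forall a, A a -> a ^ g = a].
Proof.
apply: subgroup_intro => [a _|x y cx cy a Aa|x cx a Aa]; first exact: conjg1.
  by rewrite conjgM cx // cy.
by rewrite -{1}(cx a) // conjgK.
Qed.

Lemma subgroup_cent1 a : is_subgroup [set g | a ^ g = a].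
Proof.
apply: subgroup_intro => [|x y /= cx cy|x /= cx]; first exact: conjg1.
  by rewrite conjgM cx.
by rewrite -{1}cx conjgK.
Qed.

Lemma subgroup_generated A : is_subgroup (generated A).
Proof.
apply/subgroupP; split=> [K [sK _]|x y Ax Ay K KA]; first exact: subgroup1.
by case: (KA) => sK _; exact: (subgroupF sK (Ax _ KA) (Ay _ KA)).
Qed.

Lemma sub_generated A : A `<=` generated A.
Proof. exact: sub_gen_smallest. Qed.

Lemma generated_sub A H : is_subgroup H -> A `<=` H -> generated A `<=` H.
Proof. exact: smallest_sub. Qed.

Lemma generatedJ A g : (forall a, A a -> A (a ^ g)) ->
  forall x, generated A x -> generated A (x ^ g).
Proof.
move=> AJ; apply: (@generated_sub _ [set x | generated A (x ^ g)]).
  have sA := subgroup_generated A.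
  apply: subgroup_intro => [|x y /= ? ?|x /= ?]; first by rewrite /= conj1g; exact: (subgroup1 sA).
    by rewrite conjMg; exact: (subgroupM sA).
  by rewrite conjVg; exact: (subgroupV sA).
by move=> a /AJ; exact: sub_generated.
Qed.

Definition index_le H n := classes_le [set: G] (fun g h => H (g / h)) n.

Lemma index_le_sub H K n m : index_le H n -> H `<=` K -> n <= m ->
  index_le K m.
Proof. by move=> iH HK nm; apply: classes_le_sub iH _ _ nm => // x y _ _; exact: HK. Qed.

Lemma index_leI H K n m : index_le H n -> index_le K m ->
  index_le (H `&` K) (n * m).
Proof. exact: classes_leI. Qed.

Lemma index_le_seq (I : eqType) (s : seq I) (F : I -> set G) n m :
  (forall i, i \in s -> index_le (F i) n) -> size s <= m -> 0 < n ->
  index_le [set g | forall i, i \in s -> F i g] (n ^ m).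
Proof.
move=> iF sm n0.
have /classes_le_forall iF' : forall t : 'I_(size s),
  classes_le [set: G] (fun g h => F (tnth (in_tuple s) t) (g / h)) n.
  by move=> t; apply: iF; exact: mem_tnth.
apply: classes_le_sub iF' _ _ _ => //.
  move=> g h _ _ Fgh i /(nthP i)[j js <-].
  by have := Fgh (Ordinal js); rewrite (tnth_nth i).
by rewrite card_ord; apply: leq_pexp2l.
Qed.

Lemma index_le_gt0 H n : index_le H n -> 0 < n.
Proof. by move=> [f _]; apply: leq_ltn_trans (ltn_ord (f 1)). Qed.

Lemma coset_representatives H n (f : G -> 'I_n) :
  (forall g h, [set: G] g -> [set: G] h -> f g = f h -> H (g / h)) ->
  exists r : 'I_n -> G, forall g, H (g / r (f g)).
Proof.
move=> fH; have /choice[r rP] : forall i, exists r, forall g, f g = i -> H (g / r).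
  move=> i; have [[r ri]|nr] := pselect (exists r, f r = i).
    by exists r => g gi; apply: fH => //; rewrite ri.
  by exists 1 => g gi; case: nr; exists g.
by exists r => g; exact: rP.
Qed.

Lemma index_le_trans H K n m : is_subgroup H -> index_le H n ->
  classes_le H (fun g h => K (g / h)) m -> index_le K (n * m).
Proof.
move=> sH [f fH] [f' f'K].
have [r rP] := coset_representatives fH.
apply: (@classes_le_intro _ _ (fun g => (f g, f' (g / r (f g))))).
  by rewrite card_prod !card_ord.
move=> g h _ _ [e e']; have := f'K _ _ (rP g) (rP h) e'.
by rewrite e /=; gnormalize.
Qed.

Lemma index_le_conj H n g : index_le H n -> index_le [set h | H (h ^ g)] n.
Proof.
move=> iH; have := @classes_le_preim _ _ (fun h => h ^ g) _ _ _ iH.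
by move=> i; apply: classes_le_sub i _ _ _ => // x y _ _; rewrite /= conjMg conjVg.
Qed.

Definition core H : set G := [set g | forall h, H (g ^ h)].

Lemma core_subgroup H : is_subgroup H -> is_subgroup (core H).
Proof.
move=> sH; apply: subgroup_intro => [h|x y Hx Hy h|x Hx h].
- by rewrite conj1g; exact: (subgroup1 sH).
- by rewrite conjMg; exact: (subgroupM sH).
- by rewrite conjVg; exact: (subgroupV sH).
Qed.

Lemma coreJ H g h : core H g -> core H (g ^ h).
Proof. by move=> cg h'; rewrite -conjgM. Qed.

Lemma core_sub H : core H `<=` H.
Proof. by move=> g /(_ 1); rewrite conjg1. Qed.

(** The core is the kernel of the action on the right cosets: [g] is coloured by the colours of the
    [r i * g], which leaves [n ^ n] possibilities. *)
Lemma index_le_core H n : is_subgroup H -> index_le H n ->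
  index_le (core H) (n ^ n).
Proof.
move=> sH [f fH].
have [r rP] := coset_representatives fH.
apply: (@classes_le_intro _ _ (fun g => [ffun i => f (r i * g)])).
  by rewrite card_ffun !card_ord.
move=> g g' _ _ /ffunP e h.
have := e (f h^-1); rewrite !ffunE => /(fH _ _ I I).
have hr := rP h^-1; set s := r _ in hr *.
move=> Hs; have := subgroupJ sH Hs (subgroupV sH hr).
by gnormalize.
Qed.

End Subgroups.

(** * Products of elements of a normal set *)

Section Words.
Variable G : groupType.
Implicit Types (X : set G) (c x y g h : G) (w : seq G).

Fixpoint words X n x : Prop :=
  if n is n'.+1 then exists c y, [/\ X c, words X n' y & x = c * y] else x = 1.

Lemma words_cat X n m x y : words X n x -> words X m y -> words X (n + m) (x * y).
Proof.
elim: n x => [|n IHn] x /=; first by move=> ->; rewrite mul1g.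
by move=> [c [z [Xc Wz ->]]] Wy; exists c, (z * y); rewrite mulgA; split=> //; exact: IHn.
Qed.

Lemma words1 X x : X x -> words X 1 x.
Proof. by move=> Xx; exists x, 1; rewrite mulg1. Qed.

Lemma words_leq X n m x : X 1 -> n <= m -> words X n x -> words X m x.
Proof.
move=> X1 /subnKC <- Wx; rewrite -[x]mulg1; apply: words_cat => //.
by elim: (m - n) => //= k IHk; exists 1, 1; rewrite mulg1.
Qed.

Lemma words_seqP X n x : words X n x <->
  exists w, [/\ size w = n, forall c, c \in w -> X c & \prod_(c <- w) c = x].
Proof.
split.
  elim: n x => [|n IHn] x /=; first by move=> ->; exists [::]; rewrite big_nil.
  move=> [c [y [Xc /IHn[w [sw Xw <-]] ->]]]; exists (c :: w).
  split=> [/=|d|]; [by rewrite sw| |by rewrite big_cons].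
  by rewrite inE => /orP[/eqP->|/Xw].
move=> [w [<- Xw <-]]; elim: w Xw => [|c w IHw] Xw /=; first by rewrite big_nil.
rewrite big_cons; exists c, (\prod_(d <- w) d); split=> //.
  by apply: Xw; rewrite mem_head.
by apply: IHw => d dw; apply: Xw; rewrite inE dw orbT.
Qed.

Lemma words_subgroup X n x H : is_subgroup H -> X `<=` H -> words X n x -> H x.
Proof.
move=> sH XH; elim: n x => [|n IHn] x /=; first by move=> ->; exact: subgroup1.
by move=> [c [y [/XH Hc /IHn Hy ->]]]; exact: (subgroupM sH).
Qed.

Lemma wordsV X n x : (forall y, X y -> X y^-1) -> words X n x -> words X n x^-1.
Proof.
move=> XV; elim: n x => [|n IHn] x; first by move=> ->; rewrite invg1.
move=> [c [z [Xc Wz ->]]]; rewrite invgM -addn1.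
exact: words_cat (IHn _ Wz) (words1 (XV _ Xc)).
Qed.

Lemma generated_words X x : (forall y, X y -> X y^-1) -> generated X x ->
  exists n, words X n x.
Proof.
move=> XV; apply: (@generated_sub _ _ [set y | exists n, words X n y]).
  apply: subgroup_intro => [|y z [n Wy] [m Wz]|y [n Wy]]; first by exists 0.
    by exists (n + m); exact: words_cat.
  by exists n; exact: wordsV.
by move=> c Xc; exists 1%N; exact: words1.
Qed.

(** An occurrence of [c] is moved to the front by conjugating the letters before it by [c]; as
    [c ^ c = c], no other occurrence of [c] is lost. *)
Lemma words_collect X c j w : (forall x y, X x -> X y -> X (x ^ y)) ->
  (forall x, x \in w -> X x) -> j <= count_mem c w ->
  exists w', [/\ (size w' + j)%N = size w, forall x, x \in w' -> X x &
    \prod_(x <- w) x = c ^+ j * \prod_(x <- w') x].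
Proof.
move=> XJ; elim: j w => [|j IHj] w Xw jw.
  by exists w; rewrite addn0 expg0 mul1g.
have cw : c \in w by rewrite -has_pred1 has_count; exact: leq_trans jw.
case/splitPr: cw Xw jw => w1 w2 Xw jw.
have Xc : X c by apply: Xw; rewrite mem_cat mem_head orbT.
pose v := [seq x ^ c | x <- w1] ++ w2.
have Xv x : x \in v -> X x.
  rewrite mem_cat => /orP[/mapP[y yw ->]|xw].
    by apply: XJ => //; apply: Xw; rewrite mem_cat yw.
  by apply: Xw; rewrite mem_cat inE xw !orbT.
have jv : j <= count_mem c v.
  have: j < count_mem c w1 + (1 + count_mem c w2).
    by move: jw; rewrite count_cat /= eqxx.
  rewrite addnCA add1n ltnS count_cat count_map => /leq_trans; apply.
  rewrite leq_add2r; apply: eq_leq; apply: eq_count => x /=.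
  by rewrite -(inj_eq (conjg_inj c) x c) [c ^ c]/conjg mulKg.
have [w' [sw' Xw' pw']] := IHj v Xv jv.
exists w'; split=> //.
  by rewrite addnS sw' !size_cat size_map /= addnS.
rewrite expgS -mulgA -pw' !big_cat /= big_cons big_map -conjg_prod.
by rewrite [in RHS]mulgA -conjgC mulgA.
Qed.

Lemma words_shorten X r q w : X 1 -> (forall x y, X x -> X y -> X (x ^ y)) ->
  classes_le X eq r -> (forall c, X c -> words X q (c ^+ q.+1)) ->
  (forall x, x \in w -> X x) -> words X (r * q) (\prod_(x <- w) x).
Proof.
move=> X1 XJ [f fX] Xq; have [n] := ubnP (size w).
elim: n w => // n IHn w; rewrite ltnS => wn Xw.
have [wrq|rqw] := leqP (size w) (r * q).
  by apply: (words_leq X1 wrq); apply/words_seqP; exists w.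
(* More than [r * q] letters in [r] colours: one colour, hence one letter, occurs more than [q]
   times. *)
have [i iw] : exists i : 'I_r, q < count (fun x => f x == i) w.
  apply/existsP; rewrite -[X in is_true X]negbK negb_exists.
  apply: contraL rqw => /forallP qi; rewrite -leqNgt.
  have -> : size w = (\sum_(i < r) count (fun x => f x == i) w)%N.
    elim: (w) => [|x v IHv]; first by rewrite big1.
    by rewrite /= big_split /= -IHv (bigD1 (f x)) //= eqxx big1 // => i /negPf;
       rewrite eq_sym => ->.
  rewrite -[r in (r * q)%N]card_ord -sum_nat_const; apply: leq_sum => i _.
  by rewrite leqNgt; exact: qi.
have /hasP[c cw /eqP fci] : has (fun x => f x == i) w.
  by rewrite has_count; exact: leq_ltn_trans iw.
have cq : q.+1 <= count_mem c w.
  apply: leq_trans iw _; apply: eq_leq; apply: eq_in_count => x xw /=.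
  apply/eqP/eqP => [e|->//]; apply: fX; [exact: Xw|exact: Xw|by rewrite e].
have [w' [sw' Xw' ->]] := words_collect XJ Xw cq.
have /words_seqP[v [sv Xv <-]] := Xq c (Xw _ cw).
rewrite -big_cat /=; apply: IHn.
  by rewrite size_cat sv; apply: leq_trans wn; rewrite -sw' addnS addnC.
by move=> x; rewrite mem_cat => /orP[/Xv|/Xw'].
Qed.

(* Generalizes Dietzmann's lemma (where the elements of [X] have finite order):
   a letter occurring more than [q] times in a word can be collected, and then
   the word gets shorter. *)
Lemma generated_classes_le X r q : X 1 -> (forall x, X x -> X x^-1) ->
  (forall x y, X x -> X y -> X (x ^ y)) ->
  classes_le X eq r -> (forall c, X c -> words X q (c ^+ q.+1)) ->
  classes_le (generated X) eq (r ^ (r * q)).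
Proof.
move=> X1 XV XJ rX Xq.
have Wgen x : generated X x -> exists w : (r * q).-tuple G,
    (forall c, c \in w -> X c) /\ \prod_(c <- w) c = x.
  move=> /(generated_words XV)[n /words_seqP[w [_ Xw <-]]].
  have /words_seqP[v [sv Xv <-]] := words_shorten X1 XJ rX Xq Xw.
  by exists (Tuple (introT eqP sv)).
have /choice[w wP] : forall x, exists w : (r * q).-tuple G, generated X x ->
    (forall c, c \in w -> X c) /\ \prod_(c <- w) c = x.
  move=> x; have [/Wgen[w ?]|nx] := pselect (generated X x); first by exists w.
  by exists [tuple of nseq (r * q) 1].
have [f fX] := rX.
apply: (@classes_le_intro _ _ (fun x => [tuple of map f (w x)])).
  by rewrite card_tuple card_ord.
move=> x y /wP[Xwx px] /wP[Xwy py] /(congr1 val) /= e.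
rewrite -px -py; congr (\prod_(c <- _) c).
apply: (@eq_from_nth _ 1); rewrite ?size_tuple // => i ir.
apply: fX; [by apply: Xwx; rewrite mem_nth ?size_tuple|
  by apply: Xwy; rewrite mem_nth ?size_tuple|].
by rewrite -!(nth_map 1 (f 1)) ?size_tuple // e.
Qed.

End Words.

(** * Elements with few conjugates *)

Section Small.
Variable G : groupType.
Implicit Types (x y b g h : G) (X : set G) (S : seq G) (n m : nat).

Definition small n : set G := [set x | index_le [set g | x ^ g = x] n].

Lemma small_sub n m : n <= m -> small n `<=` small m.
Proof. by move=> nm x Bx; exact: index_le_sub Bx _ nm. Qed.

Lemma small1 n : 0 < n -> small n 1.
Proof.
by case: n => // n _; exists (fun=> ord0) => g h _ _ _ /=; rewrite conj1g.
Qed.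

Lemma smallM n m x y : small n x -> small m y -> small (n * m) (x * y).
Proof.
move=> Bx By; apply: index_le_sub (index_leI Bx By) _ _ => //.
by move=> g [/= xg yg]; rewrite /= conjMg xg yg.
Qed.

Lemma smallV n x : small n x -> small n x^-1.
Proof.
by move=> Bx; apply: index_le_sub Bx _ _ => // g /= xg; rewrite /= conjVg xg.
Qed.

Lemma smallJ n x y : small n x -> small n (x ^ y).
Proof.
move=> Bx; apply: index_le_sub (index_le_conj y^-1 Bx) _ _ => // g /= e.
by rewrite -conjgM [y * g]conjgCV conjgM e.
Qed.

Lemma small_words n k x : words (small n) k x -> small (n ^ k) x.
Proof.
elim: k x => [|k IHk] x /=; first by move=> ->; exact: small1.
by move=> [c [y [Bc /IHk By ->]]]; rewrite expnS; exact: smallM.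
Qed.

Lemma small_classes_small n : @small_classes G n `<=` small n.
Proof.
move=> x /card_le_classes_le; case; first by exists x, 1 => //; exact: conjg1.
move=> f fP; exists (fun g => f (x ^ g)) => g h _ _ /fP e /=.
by rewrite conjgM e ?conjgK //; [exists g|exists h].
Qed.

Definition covered X n S := forall x, X x ->
  exists b s, [/\ small n b, s \in S & x = b * s].

End Small.

(* If some [x] in [X] lies in [small (phi n)] but not in [small n], then the
   representative [s] of its coset is superfluous up to enlarging [n]. *)
Lemma covered_gap (phi : nat -> nat) n k : 0 < n -> (forall m, 0 < phi m) ->
  exists bound, forall (G : groupType) (X : set G) (S : seq G),
  size S <= k -> covered X n (1 :: S) ->
  exists m S', [/\ 0 < m, m <= bound, size S' <= k, covered X m (1 :: S') &
                  forall x, X x -> small (phi m) x -> small m x].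
Proof.
move=> n0 phi0; elim: k n n0 => [|k IHk] n n0.
  exists n => G X S; case: S => // _ cX; exists n, [::]; split=> // x /cX.
  by move=> [b [s [Bb]]]; rewrite inE => /eqP-> -> _; rewrite mulg1.
(* [s = b^-1 * x] lies in [small (n * phi n)], so [c * s] lies in [small (n * (n * phi n))] for [c]
   in [small n]. *)
have n'0 : 0 < n * (n * phi n) by rewrite !muln_gt0 n0 phi0.
have [bound IH] := IHk _ n'0; exists (n + bound) => G X S sS cX.
have [gap|] := pselect (forall x, X x -> small (phi n) x -> small n x).
  by exists n, S; split=> //; exact: leq_addr.
move=> /existsNP[x /not_implyP[Xx /not_implyP[Bx nBx]]].
have [b [s [Bb sS1 xbs]]] := cX x Xx.
have Bs : small (n * phi n) s.
  by rewrite -[s](mulKg b) -xbs; apply: smallM => //; exact: smallV.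
have {}sS1 : s \in S.
  by move: sS1; rewrite inE => /orP[/eqP s1|//]; case: nBx; rewrite xbs s1 mulg1.
have le1 : n <= n * (n * phi n) by rewrite leq_pmulr // muln_gt0 n0 phi0.
have [|y Xy|m [S' [? ? ? ? ?]]] := IH G X (rem s S).
- by rewrite size_rem // -subn1 leq_subLR add1n.
- have [c [t [Bc tS yct]]] := cX y Xy.
  have [ets|nts] := eqVneq t s.
    exists (c * t), 1; rewrite mulg1 mem_head; split=> //.
    by apply: smallM => //; rewrite ets.
  exists c, t; split=> //; first exact: small_sub Bc.
  move: tS; rewrite !inE => /orP[->//|tS]; apply/orP; right.
  by move: tS; rewrite (perm_mem (perm_to_rem sS1)) inE (negPf nts).
- exists m, S'; split=> //; first by rewrite (leq_trans _ (leq_addl _ _)).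
  exact: leqW.
Qed.

(* B. H. Neumann's covering lemma, with a crude bound. *)
Lemma index_le_cover s m : exists bound, forall (G : groupType)
  (D : 'I_s -> set G) (R : 'I_s -> seq G), (forall i, is_subgroup (D i)) ->
  (forall i, size (R i) <= m) ->
  (forall g, exists i r, r \in R i /\ D i (g / r)) ->
  exists i, index_le (D i) bound.
Proof.
elim: s m => [|s IHs] m; first by exists 0 => G D R _ _ /(_ 1)[[]].
have [bound IH] := IHs (m + m * m); exists (m + bound) => G D R sD sR cov.
pose D0 := D ord0; pose R0 := R ord0.
have [cov0|] := pselect (forall g, exists2 r, r \in R0 & D0 (g / r)).
  exists ord0; have /choice[f fP] : forall g, exists i : 'I_(size R0),
      D0 (g / nth 1 R0 i).
    move=> g; have [r rR Dr] := cov0 g.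
    have := rR; rewrite -index_mem => ri; exists (Ordinal ri) => /=.
    by rewrite nth_index.
  apply: (@classes_le_intro _ _ f).
    by rewrite card_ord (leq_trans (sR _)) // leq_addr.
  move=> g h _ _ e; have := subgroupF (sD _) (fP g) (fP h).
  by rewrite e; gnormalize.
(* The coset of [v] misses all cosets of [D0] in the covering, so the other subgroups cover it; its
   translates cover every coset of [D0], at the cost of [m * m] more cosets of each of them. *)
move=> /existsNP[v nv].
have /choice[u uP] : forall r, exists u, forall g, D0 (g / r) -> D0 (g / u) /\ D0 (u / r).
  move=> r; have [[u ur]|nu] := pselect (exists u, D0 (u / r)).
    exists u => g gr; split=> //; have := subgroupF (sD _) gr ur.
    by gnormalize.
  by exists 1 => g gr; case: nu; exists g.
have [|i|g|i Di] := IH G (fun i => D (lift ord0 i)) (fun i => R (lift ord0 i) ++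
    [seq r / v * u r0 | r <- R (lift ord0 i), r0 <- R0]).
- by move=> i; exact: sD.
- rewrite size_cat size_allpairs; apply: leq_add; first exact: sR.
  by apply: leq_mul; exact: sR.
- have [i [r [rR Dr]]] := cov g.
  have [j def_i|def_i] := unliftP ord0 i.
    by exists j, r; rewrite -def_i mem_cat rR.
  move: rR Dr; rewrite def_i => rR /(uP r)[Du Dur].
  have [i' [r' [rR' Dr']]] := cov (g / u r * v).
  have [j def_i'|def_i'] := unliftP ord0 i'.
    exists j, (r' / v * u r); rewrite mem_cat -def_i'; split.
      by apply/orP; right; apply: allpairs_f.
    by move: Dr'; gnormalize.
  case: nv; exists r'; first by move: rR'; rewrite def_i'.
  move: Dr'; rewrite def_i' => Dr'.
  by have := subgroupM (sD _) (subgroupV (sD _) Du) Dr'; gnormalize.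
- by exists (lift ord0 i); apply: index_le_sub Di _ _ => //; exact: leq_addl.
Qed.

Lemma index_le_reps (G : groupType) (H : set G) n : index_le H n ->
  exists R : seq G, size R = n /\ forall g, exists2 r, r \in R & H (g / r).
Proof.
move=> [f fH].
have [r rP] := coset_representatives fH.
exists [seq r i | i <- enum 'I_n]; rewrite size_map size_enum_ord; split=> // g.
by exists (r (f g)); [apply: map_f; rewrite mem_enum|exact: rP g].
Qed.

(** * Commutators with a fixed element, under a gap *)

Section SmallCommutators.
Variables (G : groupType) (N k : nat).
Implicit Types x y z w : G.

(** [N * N] is the price of a product of two elements of [small N]: a commutator that is such a
    product falls back into [small N]. This makes [small_cent x] a subgroup. *)
Definition comm_gap := (exists2 S : seq G, size S <= k &
    covered (Comm [set: G] [set: G]) N (1 :: S)) /\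
  (forall x y, small (N * N) [~ x, y] -> small N [~ x, y]).

Hypothesis gapG : comm_gap.

Definition small_cent x : set G := [set y | small N [~ x, y]].

Lemma small_centC x y : small_cent x y -> small_cent y x.
Proof. by rewrite /small_cent /= -(invgR x y); exact: smallV. Qed.

(** If [[~ x, y]] and [[~ x, y']] have the same representative, [[~ x, y / y']] is conjugate to a
    quotient of two elements of [small N]. *)
Lemma index_small_cent x : index_le (small_cent x) k.+1.
Proof.
have [[S sS cov] gap] := gapG.
have /choice[f fP] : forall y, exists i : 'I_(size S).+1,
    exists2 b, small N b & [~ x, y] = b * nth 1 (1 :: S) i.
  move=> y; have [|b [s [Bb sS' e]]] := cov [~ x, y]; first by exists x => //; exists y.
  have := sS'; rewrite -index_mem => ls; exists (Ordinal ls), b => //=.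
  by rewrite nth_index.
apply: (@classes_le_intro _ _ f); first by rewrite card_ord.
move=> y y' _ _ eyy'; have [b Bb eb] := fP y; have [b' Bb' eb'] := fP y'.
apply: gap; have -> : [~ x, y / y'] = ((b / b') ^ x^-1) ^ (y'^-1 * x).
  rewrite -[b](mulgK (nth 1 (1 :: S) (f y))) -eb {1}eyy'.
  by rewrite -[b'](mulgK (nth 1 (1 :: S) (f y'))) -eb'; gnormalize.
by do 2 apply: smallJ; apply: smallM => //; exact: smallV.
Qed.

Lemma small_cent_subgroup x : is_subgroup (small_cent x).
Proof.
have [_ gap] := gapG.
have N0 : 0 < N.
  have [[S sS cov] _] := gapG; have [|b [s [Bb _ _]]] := cov 1.
    by exists 1 => //; exists 1 => //; rewrite comm1g.
  exact: index_le_gt0 Bb.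
apply: subgroup_intro => [|y z By Bz|y By]; rewrite /small_cent /=.
- by rewrite commg1; exact: small1.
- apply: gap; have -> : [~ x, y * z] = [~ x, z] * [~ x, y] ^ z by gnormalize.
  by apply: smallM => //; exact: smallJ.
- have -> : [~ x, y^-1] = ([~ x, y]^-1) ^ y^-1 by gnormalize.
  exact/smallJ/smallV.
Qed.

End SmallCommutators.

(** * Levels and separated families *)

(** [P L m] will say that some [m] elements are separated at level [L]. The aim is a level where no
    [m.+1] elements are separated, while [m] elements are separated even at the next level; each
    failure replaces [K] by [phi K] and lowers the possible size by one. *)
Lemma separation_gap (P : nat -> nat -> Prop) (phi : nat -> nat) r K :
  (forall K, P K 0) -> ~ P K r.+1 ->
  exists i m, [/\ i <= r, m <= r, P (phi (iter i phi K)) m &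
                  ~ P (iter i phi K) m.+1].
Proof.
elim: r K => [|r IHr] K P0 nP; first by exists 0, 0; split=> //.
have [PK|nPK] := pselect (P (phi K) r.+1); first by exists 0, r.+1.
have [i [m [ir mr Pm nPm]]] := IHr _ P0 nPK; exists i.+1, m.
by rewrite iterSr; split=> //; exact: leqW.
Qed.

Section Separated.
Variable G : groupType.
Implicit Types (T : set G) (z : nat -> G).

Definition separated T m z := forall i j, i < j -> j < m -> ~ T (z i / z j).

Lemma separated0 T z : separated T 0 z.
Proof. by move=> i j. Qed.

(** In the family with [w] prepended, the pair that is not separated cannot lie inside [z], so it
    involves [w]. *)
Lemma separated_max T T' m z w : T `<=` T' -> separated T' m z ->
  (forall z', ~ separated T m.+1 z') -> exists2 j, j < m & T (w / z j).
Proof.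
move=> TT' sz max.
have /existsNP[i /existsNP[j]] := max (fun i => if i is i'.+1 then z i' else w).
move=> /not_implyP[ij /not_implyP[jm /contrapT Tij]].
case: i j ij jm Tij => [|i] [|j] //=; first by move=> _ jm Tj; exists j.
by move=> ij jm /TT' /sz; case.
Qed.

Lemma separated_index T H n z : index_le H n -> H `<=` T -> ~ separated T n.+1 z.
Proof.
move=> iH HT sz; have [//|i [j [ij jn Hij _]]] := classes_le_pigeonhole (x := z) iH.
exact: sz (HT _ Hij).
Qed.

End Separated.

(** * Metabelian groups *)

Section Metabelian.
Variable G : groupType.
Implicit Types x y z t a b g h : G.
Hypothesis mab : forall x y z t : G, commute [~ x, y] [~ z, t].

Let A : set G := generated (Comm [set: G] [set: G]).

Let sA : is_subgroup A. Proof. exact: subgroup_generated. Qed.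

Lemma derA x y : A [~ x, y].
Proof. by apply: sub_generated; exists x => //; exists y. Qed.

Lemma derA_abelian a b : A a -> A b -> a ^ b = a.
Proof.
have cA c : Comm [set: G] [set: G] c -> A `<=` [set g | c ^ g = c].
  move=> [x _ [y _ <-]]; apply: generated_sub; first exact: subgroup_cent1.
  by move=> _ [z _ [t _ <-]] /=; apply/conjg_fixP/commgP/mab.
move=> Aa Ab; have /(_ _ Aa)/= : A `<=` [set g | b ^ g = b].
  apply: generated_sub; first exact: subgroup_cent1.
  move=> c Cc /=; apply/conjg_fixP/commgP/commute_sym/commgP/conjg_fixP.
  exact: cA.
by move=> e; apply/conjg_fixP/commgP/commute_sym/commgP/conjg_fixP.
Qed.

Lemma derA_comm a b : A a -> A b -> [~ a, b] = 1.
Proof. by move=> Aa Ab; rewrite commgEl derA_abelian // mulVg. Qed.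

Lemma derAC a b : A a -> A b -> a * b = b * a.
Proof. by move=> Aa Ab; rewrite conjgC derA_abelian. Qed.

Lemma derJ a g : A a -> A (a ^ g).
Proof.
move=> Aa; rewrite -[a ^ g](mulVKg a) -/(commg a g).
exact: (subgroupM sA Aa (derA _ _)).
Qed.

Lemma commM_A a b z : A a -> A b -> [~ a * b, z] = [~ a, z] * [~ b, z].
Proof.
move=> Aa Ab; have -> : [~ a * b, z] = [~ a, z] ^ b * [~ b, z] by gnormalize.
by rewrite (derA_abelian (derA _ _) Ab).
Qed.

(** [A] is abelian, so [G] acts on it through [G / A], which is abelian too; [z] and [z ^ w] thus
    act alike. *)
Lemma commJ_A a z w : A a -> [~ a ^ w, z] = [~ a, z] ^ w.
Proof.
move=> Aa; rewrite conjRg.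
have -> : [~ a ^ w, z ^ w] = [~ a ^ w, [~ z, w]] * [~ a ^ w, z] ^ [~ z, w].
  by gnormalize.
rewrite (derA_abelian (derA _ _) (derA _ _)).
by rewrite (derA_comm (derJ _ Aa) (derA _ _)) mul1g.
Qed.

Lemma commV_A a z : A a -> [~ a^-1, z] = [~ a, z]^-1.
Proof.
move=> Aa; apply/esym/mulg1_eq; rewrite -(commM_A _ Aa (subgroupV sA Aa)).
by rewrite mulgV comm1g.
Qed.

Lemma commC_A a z t : A a -> [~ a, z, t] = [~ a, t, z].
Proof.
move=> Aa; rewrite {1}[[~ a, z]]commgEl.
by rewrite (commM_A _ (subgroupV sA Aa) (derJ _ Aa)) commV_A ?commJ_A.
Qed.

(** The Hall-Witt identity; [W] removes its conjugations and inverses, since commutators commute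
    with each other. *)
Lemma jacobi x y z : [~ x, y, z] = [~ z, y, x] * [~ x, z, y].
Proof.
have W (u v w : G) : [~ u, v^-1, w] ^ v = [~ v, u, w].
  rewrite conjRg; have -> : [~ u, v^-1] ^ v = [~ v, u] by gnormalize.
  have -> : w ^ v = w * [~ w, v] by gnormalize.
  have -> : [~ [~ v, u], w * [~ w, v]] =
     [~ [~ v, u], [~ w, v]] * [~ [~ v, u], w] ^ [~ w, v] by gnormalize.
  rewrite (derA_abelian (derA _ _) (derA _ _)).
  by rewrite (derA_comm (derA _ _) (derA _ _)) mul1g.
have : [~ y, x, z] * [~ z, y, x] * [~ x, z, y] = 1.
  rewrite -(W x y z) -(W y z x) -(W z x y); gnormalize. by [].
rewrite -(invgR y x) commV_A; last exact: derA.
by move=> e; apply: (mulgI [~ y, x, z]); rewrite mulgV mulgA e.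
Qed.

Definition ker3 x z : set G := [set y | [~ x, y, z] = 1].

(** In each variable the triple commutator is a crossed homomorphism; this twisted multilinearity
    suffices to make kernels subgroups and to run Neumann's argument. *)
Lemma comm3Ml x x' y z : [~ x * x', y, z] = [~ x, y, z] ^ x' * [~ x', y, z].
Proof.
have -> : [~ x * x', y] = [~ x, y] ^ x' * [~ x', y] by gnormalize.
by rewrite (commM_A _ (derJ _ (derA _ _)) (derA _ _)) (commJ_A _ _ (derA _ _)).
Qed.

Lemma comm3Mr x y y' z : [~ x, y * y', z] = [~ x, y, z] ^ y' * [~ x, y', z].
Proof.
have -> : [~ x, y * y'] = [~ x, y'] * [~ x, y] ^ y' by gnormalize.
rewrite (commM_A _ (derA _ _) (derJ _ (derA _ _))) (commJ_A _ _ (derA _ _)).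
by rewrite (derAC (derA _ _) (derJ _ (derA _ _))).
Qed.

Lemma comm3M x y z z' : [~ x, y, z * z'] = [~ x, y, z] ^ z' * [~ x, y, z'].
Proof.
have -> : [~ x, y, z * z'] = [~ x, y, z'] * [~ x, y, z] ^ z' by gnormalize.
by rewrite (derAC (derA _ _) (derJ _ (derA _ _))).
Qed.

Lemma crossed_ker_subgroup (F : G -> G) :
  (forall g h, F (g * h) = F g ^ h * F h) -> is_subgroup [set g | F g = 1].
Proof.
move=> FM; have F1 : F 1 = 1 by apply: (mulgI (F 1)); rewrite -{1}[F 1]conjg1 -FM !mulg1.
apply: subgroup_intro => [//|x y /= Fx Fy|x /= Fx]; first by rewrite FM Fx conj1g mul1g.
by have := FM x x^-1; rewrite mulgV F1 Fx conj1g mul1g.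
Qed.

Lemma ker3_subgroup x z : is_subgroup (ker3 x z).
Proof. by apply: crossed_ker_subgroup => y y'; exact: comm3Mr. Qed.

End Metabelian.

(** * Kernels of triple commutators *)

Definition metabelian (G : groupType) :=
  forall x y z t : G, commute [~ x, y] [~ z, t].

Section Ker3.
Variables (G : groupType) (mab : metabelian G).
Implicit Types x y z t : G.

Definition ker3_le x n : set G := [set z | index_le (ker3 x z) n].

Lemma ker3_leM x z z' n m : ker3_le x n z -> ker3_le x m z' ->
  ker3_le x (n * m) (z * z').
Proof.
move=> zn zm; apply: index_le_sub (index_leI zn zm) _ _ => // y [/= e e'].
by rewrite /ker3 /= comm3M // e e' conj1g mulg1.
Qed.

Lemma ker3_leV x z n : ker3_le x n z -> ker3_le x n z^-1.
Proof.
move=> zn; apply: index_le_sub zn _ _ => // y /= e; rewrite /ker3 /=.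
have := comm3M mab x y z z^-1.
by rewrite mulgV commg1 e conj1g mul1g.
Qed.

Lemma ker3_leMl x x' z n m : ker3_le x n z -> ker3_le x' m z ->
  ker3_le (x * x') (n * m) z.
Proof.
move=> zn zm; apply: index_le_sub (index_leI zn zm) _ _ => // y [/= e e'].
by rewrite /ker3 /= comm3Ml // e e' conj1g mulg1.
Qed.

Lemma ker3_leVl x z n : ker3_le x n z -> ker3_le x^-1 n z.
Proof.
move=> zn; apply: index_le_sub zn _ _ => // y /= e; rewrite /ker3 /=.
have := comm3Ml mab x x^-1 y z.
by rewrite mulgV !comm1g e conj1g mul1g.
Qed.

(** In [[~ x, y, z] = [~ z, y, x] * [~ x, z, y]] the last factor vanishes as soon as [y] centralizes
    [[~ x, z]]. *)
Lemma ker3_leC x z n N : ker3_le z n x -> small N [~ x, z] ->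
  ker3_le x (n * N) z.
Proof.
move=> zn xzN; apply: index_le_sub (index_leI zn xzN) _ _ => // y [/= e e'].
by rewrite /ker3 /= jacobi // e mul1g commgEl e' mulVg.
Qed.

End Ker3.

(** For every [g] some [r] out of [k.+1] puts [[~ x, g / r]] in [small N], so one of the quotients
    [z i / z j] of the [N.+1] elements centralizes it. Hence cosets of the [ker3 x (z i / z j)]
    cover [G], and one of these subgroups has bounded index. *)
Lemma ker3_separated N k : exists K, forall G : groupType, metabelian G ->
  comm_gap G N k ->
  forall (x : G) z, ~ separated (ker3_le x K) N.+1 z.
Proof.
have [K KP] := index_le_cover #|{: 'I_N.+1 * 'I_N.+1}| k.+1.
exists K => G mab gapG x z sz.
have [R [sR RP]] := index_le_reps (index_small_cent gapG x).
have N0 : 0 < N by have [r _ /index_le_gt0] := RP 1.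
(* Pairs that are not increasing get no coset, but the covering lemma could still return one of
   them; [z 0 / z 1] is put there, a legal pair because [N] is positive. *)
pose w (p : 'I_N.+1 * 'I_N.+1) := if p.1 < p.2 then z p.1 / z p.2 else z 0 / z 1%N.
have [|p|g|p] := KP G (fun p => ker3 x (w (enum_val p)))
   (fun p => if (enum_val p).1 < (enum_val p).2 then R else [::]).
- by move=> p; exact: ker3_subgroup.
- by case: ifP; rewrite ?sR.
- have [r rR Br] := RP g.
  have [//|i [j [ij jN e _]]] := classes_le_pigeonhole (x := z) Br.
  exists (enum_rank (inord i : 'I_N.+1, inord j : 'I_N.+1)), r.
  have iN := ltn_trans ij (jN : j < N.+1).
  rewrite enum_rankK /w /= !inordK ?ij //.
  by split=> //; rewrite /ker3 /= commgEl e mulVg.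
- rewrite /w; case: ifP => [plt|_]; first exact: sz.
  exact: sz.
Qed.

(** [T L] is closed under products at a level [L] where a maximal separated family stays separated
    at [phi L]. For this [w * w' * z 0] is compared with the [z j]: if it were equivalent to [z j]
    with [j > 0], then [z 0 / z j] would lie in [T (L * L * L)]. *)
Lemma ker3_index N k : exists n, forall G : groupType, metabelian G ->
  comm_gap G N k -> forall x : G,
  exists Z, [/\ is_subgroup Z, index_le Z n & Z `<=` ker3_le x n].
Proof.
have [K KP] := ker3_separated N k; pose phi m := (m * m * m)%N.
pose n := (\max_(i < N.+1) iter i phi K.+1 + N)%N.
(* The levels start at [K.+1] instead of [K] to be positive, so that [L <= phi L]. *)
exists n => G mab gapG x.
pose T := ker3_le x.
have Tsub m m' : m <= m' -> T m `<=` T m'.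
  by move=> mm z Hz; exact: (index_le_sub Hz _ mm).
have [||i [m [iN mN [z sz] max]]] := @separation_gap
  (fun L m => exists z, separated (T L) m z) phi N K.+1.
- by move=> L; exists (fun=> 1); exact: separated0.
- move=> [z sz]; apply: (KP G mab gapG x z) => a b ab bN Tab.
  by apply: sz ab bN _; apply: Tsub Tab; exact: leqW.
set L := iter i phi K.+1 in sz max.
have L0 : 0 < L by rewrite /L; elim: (i) => //= j L0; rewrite !muln_gt0 L0.
have Ln : L <= n.
  apply: leq_trans (leq_addr _ _).
  by have /= := leq_bigmax (F := fun i : 'I_N.+1 => iter i phi K.+1) (Ordinal (iN : i < N.+1)).
have LphiL : L <= phi L by rewrite /phi -mulnA leq_pmulr // muln_gt0 L0.
have cov w : exists2 j, j < m & T L (w / z j).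
  apply: separated_max sz _; first exact: Tsub.
  by move=> z' sz'; apply: max; exists z'.
have T1 : T L 1.
  apply: (@classes_le_intro _ _ (fun=> tt)); first by rewrite card_unit.
  by move=> g h _ _ _; rewrite /ker3 /= commg1.
have sT : is_subgroup (T L).
  apply: subgroup_intro => // [w w' Tw Tw'|w Tw]; last exact: ker3_leV.
  have [j jm Tj] := cov (w * w' * z 0).
  case: j jm Tj => [|j] jm Tj; first by move: Tj; gnormalize.
  have ww' := ker3_leM mab Tw Tw'.
  case: (sz 0 j.+1) => //.
  have -> : z 0 / z j.+1 = (w * w')^-1 * (w * w' * z 0 / z j.+1) by gnormalize.
  by rewrite /phi; apply: ker3_leM => //; exact: ker3_leV.
exists (T L); split=> //; last exact: Tsub.
have /choice[f fP] : forall w, exists j : 'I_m, T L (w / z j).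
  by move=> w; have [j jm Tj] := cov w; exists (Ordinal jm).
apply: (@classes_le_intro _ _ f).
  by rewrite card_ord (leq_trans mN) // leq_addl.
move=> g h _ _ e; have := subgroupF sT (fP g) (fP h).
by rewrite e; gnormalize.
Qed.

Lemma leq_max_iter (phi : nat -> nat) K r i : i <= r ->
  iter i phi K <= \max_(j < r.+1) iter j phi K.
Proof.
move=> ir.
by have /= := leq_bigmax (F := fun j : 'I_r.+1 => iter j phi K) (Ordinal (ir : i < r.+1)).
Qed.

(** The last two entries commute, so [t] may be moved before [w * z]; then [u] may be replaced by
    [x * u] because [[~ x, y, t] = 1], and the factors with [w] and [z] vanish separately. *)
Lemma comm4_ker G (mab : metabelian G) (x u w z t y : G) :
  [~ x, y, t] = 1 -> [~ x * u, y, w] = 1 -> [~ u, y, z] = 1 ->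
  [~ u, y, w * z, t] = 1.
Proof.
move=> xt xuw uz; have A := @derA G.
have e : [~ u, y, t] = [~ x * u, y, t] by rewrite (comm3Ml mab) xt conj1g mul1g.
rewrite (commC_A mab) // (comm3M mab).
by rewrite {1}e -!(commC_A mab _ t (A _ _)) xuw uz !comm1g conj1g mulg1.
Qed.

(* [x] and the [z i] realize the largest number of [z] that are pairwise
   inequivalent modulo "[{y | [x, y, z] = 1}] has bounded index". By maximality,
   for [u] orthogonal to all [z i], every [g] is equivalent to some [z i] with
   respect to [x * u]; hence, for most [y], [~ u, y, g] is a conjugate of
   [~ x, y, g / z i]^-1, which commutes with [t] when [t] is orthogonal to [x]. *)
Lemma comm4_index N k : exists n, forall G : groupType, metabelian G ->
  comm_gap G N k -> exists H : set G, [/\ is_subgroup H, index_le H n &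
  forall u z t, H u -> H z -> H t ->
    index_le [set y | [~ u, y, z, t] = 1] n].
Proof.
have [n nP] := ker3_index N k.
(* [q] is the price of exchanging the two arguments in [ker3_le]; [q * q] is that of a quotient
   [z a / z b], paid when [x * u] is replaced by [x]. *)
pose q := (n * N)%N; pose phi m := (m * (q * q))%N.
pose Lmax := \max_(j < n.+1) iter j phi n.
exists ((n * k.+1) ^ n * n + n * (Lmax * q))%N => G mab gapG.
have /choice[Z ZP] := nP G mab gapG.
have sZ x : is_subgroup (Z x) by case: (ZP x).
have iZ x : index_le (Z x) n by case: (ZP x).
have ZT x : Z x `<=` ker3_le x n by case: (ZP x).
have n0 : 0 < n by exact: index_le_gt0 (iZ 1).
have [||i [m [im mn [x [z sz]] max]]] := @separation_gap
  (fun L m => exists x z, separated (@ker3_le G x L) m z) phi n n.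
- by move=> L; exists 1, (fun=> 1); exact: separated0.
- by move=> [x [z]]; exact: (separated_index (iZ x) (ZT x)).
set L := iter i phi n in sz max.
have LLmax : L <= Lmax by exact: leq_max_iter.
(* The two conditions are those of [ker3_leC], which turns [ker3_le (z j) n u] into
   [ker3_le u q (z j)]. *)
pose U : set G := [set u | forall j, j \in iota 0 m -> (Z (z j) `&` small_cent N (z j)) u].
have sU : is_subgroup U.
  apply: (@subgroup_bigI G nat (fun j => j \in iota 0 m)
    (fun j => Z (z j) `&` small_cent N (z j))) => j _.
  by apply: subgroupI => //; exact: (small_cent_subgroup gapG).
have iU : index_le U ((n * k.+1) ^ n).
  apply: index_le_seq => [j _||].
  - by apply: index_leI => //; exact: (index_small_cent gapG).
  - by rewrite size_iota.
  - by rewrite muln_gt0 n0.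
have Uz u j : U u -> j < m -> ker3_le u q (z j).
  move=> Uu jm; have [|Zu Bu] := Uu j; first by rewrite mem_iota.
  by apply: ker3_leC => //; [exact: ZT|exact: small_centC].
have cov u g : U u -> exists2 j, j < m & ker3_le (x * u) L (g / z j).
  move=> Uu; apply: (@separated_max _ _ (ker3_le (x * u) L)) => //; last first.
    by move=> z' sz'; apply: max; exists (x * u), z'.
  move=> a b ab bm Tab; apply: (sz a b ab bm).
  have am := ltn_trans ab bm.
  have Tu := ker3_leM mab (Uz u a Uu am) (ker3_leV mab (Uz u b Uu bm)).
  by have := ker3_leMl mab Tab (ker3_leVl mab Tu); rewrite mulgK.
exists (U `&` Z x); split; first exact: subgroupI.
  by apply: index_le_sub (index_leI iU (iZ x)) _ _ => //; exact: leq_addr.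
move=> u g t [Uu _] _ [_ Zt]; have [j jm Tj] := cov u g Uu.
apply: index_le_sub (index_leI (ZT _ _ Zt) (index_leI Tj (Uz u j Uu jm))) _ _.
  move=> y [/= e1 [e2 e3]]; have := comm4_ker mab e1 e2 e3.
  by rewrite mulgVK.
by apply: leq_trans (leq_addl _ _); rewrite leq_mul // leq_mul.
Qed.

(** * Neumann's argument for crossed homomorphisms *)

Lemma nat_maximal (P : nat -> Prop) m : P 0 -> (forall r, P r -> r <= m) ->
  exists r, P r /\ ~ P r.+1.
Proof.
move=> P0 Pm; apply: contrapT => nP.
suff /Pm : P m.+1 by rewrite ltnn.
elim: m.+1 => // r Pr; apply: contrapT => nPr; apply: nP; by exists r.
Qed.

(** The factors count the colours of [u] for the kernels at [m] points, an optional pair of these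
    points, and the values of a representative of the colour of [u]. *)
Definition crossed_bound n m := (n ^ m * (m * m).+1 * m)%N.

(* Neumann's argument: if [x] takes the maximal number of values on [D] and [u]
   is in the kernel at points where they are attained, then [u * x] takes the
   same values as [x], whence [F u] takes its values in a fixed finite set. *)
Lemma neumann_bound (G : groupType) (H : set G) (Omega : Type) (D : set Omega)
    (F : G -> Omega -> G) n m : is_subgroup H -> 0 < n ->
  (forall u x w, H u -> H x -> D w -> F (u * x) w = F u w ^ x * F x w) ->
  (forall w, D w -> index_le [set u | F u w = 1] n) ->
  (forall x, H x -> classes_le D (fun w w' => F x w = F x w') m) ->
  classes_le [set p : G * Omega | H p.1 /\ D p.2]
    (fun p q => F p.1 p.2 = F q.1 q.2) (crossed_bound n m).
Proof.
move=> sH n0 FM Fn Fm.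
have H1 := subgroup1 sH.
pose P r := exists x (w : 'I_r -> Omega),
  [/\ H x, forall i, D (w i) & injective (fun i => F x (w i))].
have Pm r : P r -> r <= m.
  move=> [x [w [Hx Dw inj]]]; have [f fP] := Fm x Hx.
  have /leq_card : injective (f \o w) by move=> i j /fP e; apply/inj/e.
  by rewrite !card_ord.
have P0 : P 0 by exists 1, (fun i : 'I_0 => False_rect Omega (notF (valP i))); split=> // -[].
have [r [[x [w [Hx Dw inj]]] max]] := nat_maximal P0 Pm.
have rm : r <= m by apply: Pm; exists x, w.
have attained y v : H y -> injective (fun i => F y (w i)) -> D v ->
    exists i, F y v = F y (w i).
  move=> Hy injy Dv; apply: contrapT => nv; apply: max.
  exists y, (fun j => if unlift ord0 j is Some i then w i else v); split=> //.
    by move=> j; case: unliftP.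
  move=> i j /=; case: (unliftP ord0 i) => [i'|] ->; case: (unliftP ord0 j) => [j'|] -> //.
  - by move=> /injy ->.
  - by move=> e; case: nv; exists i'.
  - by move=> e; case: nv; exists j'.
have [c cP] := classes_le_forall (fun i => Fn (w i) (Dw i)).
have /choice[v vP] : forall i, exists v, forall u, H u -> c u = i ->
    [/\ H v, H (u / v) & forall j, F (u / v) (w j) = 1].
  move=> i; have [[v [Hv vi]]|nv] := pselect (exists v, H v /\ c v = i).
    exists v => u Hu ui; split=> // [|j]; first exact: (subgroupF sH).
    by apply: cP => //; rewrite ui vi.
  by exists 1 => u Hu ui; case: nv; exists u.
have /choice[e eP] : forall p : G * Omega, exists ij : option ('I_r * 'I_r),
    H p.1 -> D p.2 -> exists i j, ij = Some (i, j) /\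
    F (p.1 / v (c p.1)) p.2 = (F x (w i) / F x (w j)) ^ x^-1.
  move=> [u t]; have [[Hu Dt]|np] := pselect (H u /\ D t); last first.
    by exists None => Hu Dt; case: np.
  have [Hv Hy yw] := vP _ u Hu erefl; set y := u / v _ in Hy yw *.
  have yxw i : F (y * x) (w i) = F x (w i) by rewrite FM // yw conj1g mul1g.
  have [||i ei] := attained (y * x) t _ _ Dt; first exact: (subgroupM sH).
    by move=> i j; rewrite !yxw; exact: inj.
  have [j ej] := attained x t Hx inj Dt.
  exists (Some (i, j)) => _ _; exists i, j; split=> //=.
  by rewrite -yxw -ei -ej FM // mulgK conjgK.
have /choice[f fP] : forall i, exists f : Omega -> 'I_m, H (v i) ->
    forall s t, D s -> D t -> f s = f t -> F (v i) s = F (v i) t.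
  move=> i; have [/Fm[f ?]|nH] := pselect (H (v i)); first by exists f.
  have [f _] := Fm 1 H1; by exists f.
(* With [v] the representative, [F u s = F (u / v) s ^ v * F v s]: the pair of points determines
   [F (u / v) s], the last colour determines [F v s], and [v] depends only on the first colour. *)
apply: (@classes_le_intro _ _ (fun p => (c p.1, e p, f (c p.1) p.2))).
  rewrite !card_prod card_option card_prod !card_ord.
  by rewrite leq_mul // leq_mul ?leq_pexp2l // ltnS leq_mul.
move=> [u s] [u' t] [/= Hu Ds] [/= Hu' Dt] [ecu ee ef].
have [i [j [e1 E1]]] := eP (u, s) Hu Ds; have [i' [j' [e2 E2]]] := eP (u', t) Hu' Dt.
have [Hv Hy _] := vP _ u Hu erefl; have [Hv' Hy' _] := vP _ u' Hu' erefl.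
move: E1 E2; rewrite /= => E1 E2.
rewrite -[u](mulgVK (v (c u))) -[u'](mulgVK (v (c u'))) (FM _ _ _ Hy Hv Ds) (FM _ _ _ Hy' Hv' Dt) E1 E2.
move: e1; rewrite ee e2 => -[-> ->]; rewrite -ecu; congr (_ * _).
by apply: fP => //; rewrite ef ecu.
Qed.

Lemma classes_le_image (Y X : Type) (y0 : Y) (A : set Y) (h : Y -> X) n :
  classes_le A (fun p q => h p = h q) n -> classes_le (h @` A) eq n.
Proof.
move=> [f fP].
have /choice[s sP] : forall x, exists y, (h @` A) x -> A y /\ h y = x.
  move=> x; have [[y Ay yx]|nx] := pselect ((h @` A) x); first by exists y.
  by exists y0.
exists (f \o s) => x x' /sP[As sx] /sP[As' sx'] /= e.
by rewrite -sx -sx'; exact: fP.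
Qed.

Lemma index_le_cent_finite (G : groupType) (H X : set G) r : is_subgroup H ->
  (forall x h, X x -> H h -> X (x ^ h)) -> classes_le X eq r ->
  classes_le H (fun g h => forall x, X x -> x ^ (g / h) = x) (r ^ r).
Proof.
move=> sH XH [f fX].
have /choice[a aP] : forall i, exists a, forall x, X x -> f x = i -> x = a.
  move=> i; have [[a [Xa ai]]|na] := pselect (exists a, X a /\ f a = i).
    by exists a => x Xx xi; apply: fX => //; rewrite ai.
  by exists 1 => x Xx xi; case: na; exists x.
apply: (@classes_le_intro _ _ (fun h => [ffun i => f (a i ^ h)])).
  by rewrite card_ffun !card_ord.
move=> g h Hg Hh /ffunP e x Xx; have := e (f x); rewrite !ffunE -(aP _ x) //.
move=> /fX exgh; rewrite conjgM exgh ?conjgK //; exact: XH.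
Qed.

(** * Fourfold commutators in metabelian groups *)

Section Metabelian4.
Variables (G : groupType) (mab : metabelian G).
Implicit Types x y z t u g : G.

Definition comm4_values (H : set G) : set G :=
  [set c | exists x y z t, [/\ H x, H y, H z, H t & c = [~ x, y, z, t]]].

Lemma comm4Ml x x' y z t :
  [~ x * x', y, z, t] = [~ x, y, z, t] ^ x' * [~ x', y, z, t].
Proof.
rewrite comm3Ml // (commM_A mab) ?(commJ_A mab) //; try exact: derA.
by apply: derJ; exact: derA.
Qed.

Lemma comm4Mr x y y' z t :
  [~ x, y * y', z, t] = [~ x, y, z, t] ^ y' * [~ x, y', z, t].
Proof.
rewrite comm3Mr // (commM_A mab) ?(commJ_A mab) //; try exact: derA.
by apply: derJ; exact: derA.
Qed.

Lemma comm4M3 x y z z' t :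
  [~ x, y, z * z', t] = [~ x, y, z, t] ^ z' * [~ x, y, z', t].
Proof.
rewrite comm3M // (commM_A mab) ?(commJ_A mab) //; try exact: derA.
by apply: derJ; exact: derA.
Qed.

Lemma comm4C x y z t : [~ y, x, z, t] = [~ x, y, z, t]^-1.
Proof. by rewrite -(invgR x y) !(commV_A mab) //; exact: derA. Qed.

(** The hypothesis concerns the second variable. Antisymmetry gives the first, [jacobi] the third at
    the price of [n * n], and the exchange of the last two entries the fourth. Each further use of
    [neumann_bound] adds one variable to a domain where the values are already bounded. *)
Lemma comm4_values_bounded (H : set G) n : is_subgroup H -> 0 < n ->
  (forall u z t, H u -> H z -> H t ->
    index_le [set y | [~ u, y, z, t] = 1] n) ->
  classes_le (comm4_values H) eq
   (crossed_bound (n * n) (crossed_bound (n * n) (crossed_bound n n))).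
Proof.
move=> sH n0 Hn; have A := @derA G.
have n20 : 0 < n * n by rewrite muln_gt0 n0.
have kerx y z t : H y -> H z -> H t -> index_le [set x | [~ x, y, z, t] = 1] n.
  move=> Hy Hz Ht; apply: index_le_sub (Hn _ _ _ Hy Hz Ht) _ _ => // x /= e.
  by rewrite comm4C e invg1.
have kerz x y t : H x -> H y -> H t -> index_le [set z | [~ x, y, z, t] = 1] (n * n).
  move=> Hx Hy Ht.
  apply: index_le_sub (index_leI (kerx _ _ _ Hy Hx Ht) (Hn _ _ _ Hx Hy Ht)) _ _ => //.
  by move=> z [/= e e']; rewrite (jacobi mab x y z) (commM_A mab) // e e' mulg1.
have kert x y z : H x -> H y -> H z -> index_le [set t | [~ x, y, z, t] = 1] (n * n).
  move=> Hx Hy Hz; apply: index_le_sub (kerz _ _ _ Hx Hy Hz) _ _ => // t /= e.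
  by rewrite (commC_A mab).
have b1 z t : H z -> H t -> classes_le [set p : G * G | H p.1 /\ H p.2]
    (fun p q => [~ p.1, p.2, z, t] = [~ q.1, q.2, z, t]) (crossed_bound n n).
  move=> Hz Ht.
  apply: (neumann_bound (F := fun x y => [~ x, y, z, t])) => // [x x' y _ _ _|y Hy|x Hx].
  - exact: comm4Ml.
  - exact: kerx.
  - apply: classes_le_sub (Hn _ _ _ Hx Hz Ht) _ _ _ => // y y' _ _ /= e.
    by rewrite -[y](mulgVK y') comm4Mr e conj1g mul1g.
have b2 t : H t -> classes_le [set p : G * (G * G) | H p.1 /\ (H p.2.1 /\ H p.2.2)]
    (fun p q => [~ p.2.1, p.2.2, p.1, t] = [~ q.2.1, q.2.2, q.1, t]) (crossed_bound (n * n) (crossed_bound n n)).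
  move=> Ht.
  apply: (neumann_bound (D := [set p : G * G | H p.1 /\ H p.2])
    (F := fun z p => [~ p.1, p.2, z, t])) => //.
  - by move=> z z' p _ _ _; exact: comm4M3.
  - by move=> p [Hx Hy]; exact: kerz.
  - by move=> z Hz; exact: b1.
have b3 : classes_le [set p : G * (G * (G * G)) | H p.1 /\ (H p.2.1 /\ (H p.2.2.1 /\ H p.2.2.2))]
    (fun p q => [~ p.2.2.1, p.2.2.2, p.2.1, p.1] = [~ q.2.2.1, q.2.2.2, q.2.1, q.1])
    (crossed_bound (n * n) (crossed_bound (n * n) (crossed_bound n n))).
  apply: (neumann_bound (D := [set p : G * (G * G) | H p.1 /\ (H p.2.1 /\ H p.2.2)])
    (F := fun t p => [~ p.2.1, p.2.2, p.1, t])) => //.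
  - by move=> t t' p _ _ _; exact: comm3M.
  - by move=> p [Hz [Hx Hy]]; exact: kert.
apply: classes_le_sub (classes_le_image (1, (1, (1, 1))) b3) _ _ _ => //.
by move=> _ [x [y [z [t [Hx Hy Hz Ht ->]]]]]; exists (t, (z, (x, y))).
Qed.

(** On the derived subgroup [[~ a, z]] is multiplicative in [a], so the [a] whose further
    commutators with [H] stay in [V] form a subgroup, and it suffices to check generators. *)
Lemma lower_central4_sub (H : set G) : is_subgroup H ->
  lower_central 4 H `<=` generated (comm4_values H).
Proof.
move=> sH; have A := @derA G; set V := generated _.
have sV : is_subgroup V by exact: subgroup_generated.
pose dA : set G := generated (Comm [set: G] [set: G]).
have sdA : is_subgroup dA by exact: subgroup_generated.
pose V2 : set G := [set a | dA a /\ forall z t, H z -> H t -> V [~ a, z, t]].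
have V2P : commutator_subgroup H H `<=` V2.
  apply: generated_sub.
    apply: subgroup_intro => [|a b [Aa Va] [Ab Vb]|a [Aa Va]]; split=> [|z t Hz Ht].
    - exact: subgroup1.
    - by rewrite !comm1g; exact: subgroup1.
    - exact: (subgroupM sdA).
    - by rewrite (commM_A mab z Aa Ab) (commM_A mab t (A _ _) (A _ _)); exact: (subgroupM sV (Va _ _ Hz Ht) (Vb _ _ Hz Ht)).
    - exact: (subgroupV sdA).
    - by rewrite (commV_A mab z Aa) (commV_A mab t (A _ _)); exact: (subgroupV sV (Va _ _ Hz Ht)).
  move=> _ [x Hx [y Hy <-]]; split=> [|z t Hz Ht]; first exact: A.
  by apply: sub_generated; exists x, y, z, t.
pose V3 : set G := [set a | dA a /\ forall t, H t -> V [~ a, t]].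
have V3P : commutator_subgroup (commutator_subgroup H H) H `<=` V3.
  apply: generated_sub.
    apply: subgroup_intro => [|a b [Aa Va] [Ab Vb]|a [Aa Va]]; split=> [|t Ht].
    - exact: subgroup1.
    - by rewrite comm1g; exact: subgroup1.
    - exact: (subgroupM sdA).
    - by rewrite (commM_A mab t Aa Ab); exact: (subgroupM sV (Va _ Ht) (Vb _ Ht)).
    - exact: (subgroupV sdA).
    - by rewrite (commV_A mab t Aa); exact: (subgroupV sV (Va _ Ht)).
  by move=> _ [a /V2P[Aa Va] [z Hz <-]]; split=> [|t Ht]; [exact: A|exact: Va].
rewrite /lower_central /=; apply: generated_sub => // _ [a /V3P[_ Va] [t Ht <-]].
exact: Va.
Qed.

End Metabelian4.

Lemma metabelian_lower_central4 N k : exists M, forall G : groupType,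
  metabelian G -> comm_gap G N k -> exists H : set G,
  [/\ is_subgroup H, index_le H M & classes_le (lower_central 4 H) eq M].
Proof.
have [n nP] := comm4_index N k.
pose b n m := (n ^ m * (m * m).+1 * m)%N; pose r := b (n * n)%N (crossed_bound (n * n) (crossed_bound n n)).
exists (n * r ^ r + r ^ (r * 1))%N => G mab gapG.
have [H [sH iH Hn]] := nP G mab gapG.
have n0 : 0 < n by exact: index_le_gt0 iH.
have Vr : classes_le (comm4_values H) eq r by exact: comm4_values_bounded.
(* Once [K] centralizes the values [c = [~ x, y, z, t]], the square [[~ x, y, z, t * t]] of [c] is
   again a value, so words can be shortened with [q = 1]. *)
pose K : set G := H `&` [set h | forall a, comm4_values H a -> a ^ h = a].
have sK : is_subgroup K by apply: subgroupI => //; exact: subgroup_cent.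
have KH : comm4_values K `<=` comm4_values H.
  by move=> _ [x [y [z [t [[Hx _] [Hy _] [Hz _] [Ht _] ->]]]]]; exists x, y, z, t.
have KV a h : comm4_values K a -> K h -> a ^ h = a.
  by move=> /KH Va [_]; exact.
have K1 := subgroup1 sK.
exists K; split=> //.
- apply: index_le_sub (index_le_trans sH iH (K := K) (m := r ^ r) _) _ _ => //; last exact: leq_addr.
  have := index_le_cent_finite sH _ Vr; case=> [_ h [x [y [z [t [Hx Hy Hz Ht ->]]]]] Hh|f fP].
    by exists (x ^ h), (y ^ h), (z ^ h), (t ^ h); rewrite -!conjRg; split=> //; exact: (subgroupJ sH).
  exists f => g h Hg Hh /fP-/(_ Hg Hh) cgh; split=> //.
  exact: (subgroupF sH).
- apply: classes_le_sub (generated_classes_le (X := comm4_values K) (r := r) (q := 1) _ _ _ _ _)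
    (lower_central4_sub mab sK) _ _ => //.
  + by exists 1, 1, 1, 1; rewrite !commg1.
  + move=> _ [x [y [z [t [Hx Hy Hz Ht ->]]]]]; exists y, x, z, t.
    by split=> //; rewrite (comm4C mab x y).
  + move=> c d Vc [x [y [z [t [_ _ _ _ ->]]]]].
    suff -> : c ^ [~ x, y, z, t] = c by [].
    have [x' [y' [z' [t' [_ _ _ _ ->]]]]] := Vc.
    exact: (derA_abelian mab (derA _ _) (derA _ _)).
  + exact: classes_le_sub Vr KH _ _.
  + move=> c Vc; apply: words1; have [x [y [z [t [Hx Hy Hz Ht ec]]]]] := Vc.
    exists x, y, z, (t * t); rewrite comm3M // -ec KV //; split=> //.
    exact: (subgroupM sK).
  + exact: leq_addl.
Qed.

(** * Reduction to metabelian sections *)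

Definition comm2 (G : groupType) : set G :=
  [set c | exists x y x' y', c = [~ x, y] * [~ x', y']].

Section NormalClosure.
Variable G : groupType.
Implicit Types (P : set G) (g h x y : G).

Definition normal_subgroup P :=
  is_subgroup P /\ forall g x, P x -> P (x ^ g).

Variable P : set G.
Hypothesis nP : normal_subgroup P.
Let sP : is_subgroup P. Proof. by case: nP. Qed.

Definition eqmod g h := P (g^-1 * h).

Lemma eqmod_refl g : eqmod g g.
Proof. by rewrite /eqmod mulVg; exact: subgroup1. Qed.

Lemma eqmod_sym g h : eqmod g h -> eqmod h g.
Proof. by move=> /(subgroupV sP); rewrite /eqmod invgM invgK. Qed.

Lemma eqmod_trans g h x : eqmod g h -> eqmod h x -> eqmod g x.
Proof. by move=> gh hx; have := subgroupM sP gh hx; rewrite /eqmod; gnormalize. Qed.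

Lemma eqmodM g h x y : eqmod g h -> eqmod x y -> eqmod (g * x) (h * y).
Proof.
case: nP => _ PJ gh xy; have := subgroupM sP (PJ x _ gh) xy.
by rewrite /eqmod; gnormalize.
Qed.

Lemma eqmod1 g : eqmod g 1 <-> P g.
Proof.
rewrite /eqmod mulg1; split=> [/(subgroupV sP)|]; first by rewrite invgK.
exact: subgroupV.
Qed.

Lemma eqmodX g h n : eqmod g h -> eqmod (g ^+ n) (h ^+ n).
Proof.
move=> gh; elim: n => [|n IHn]; first by rewrite !expg0; exact: eqmod_refl.
by rewrite !expgS; exact: eqmodM.
Qed.

Lemma eqmod_conj g h : P [~ g, h] -> eqmod (g ^ h) g.
Proof. by move=> Pgh; apply: eqmod_sym. Qed.

Lemma commP_sym g h : P [~ g, h] -> P [~ h, g].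
Proof. by move=> /(subgroupV sP); rewrite invgR. Qed.

End NormalClosure.

(** * Products of two commutators as short words in B *)

Section Gap.
Variables (G : groupType) (N k : nat) (f : G -> 'I_k.+1).
Implicit Types (x y z c d e g h b l u v w : G).

Let B : set G := small N.

Hypothesis N0 : 0 < N.
Hypothesis gap : forall c, comm2 c -> small (N ^ 8) c -> B c.
Hypothesis fP : forall c c', comm2 c -> comm2 c' -> f c = f c' ->
  words B 2 (c / c').
Hypothesis gapG : comm_gap G N k.

Let B1 : B 1. Proof. exact: small1. Qed.
Let BV x : B x -> B x^-1. Proof. exact: smallV. Qed.
Let BJ x y : B x -> B (x ^ y). Proof. exact: smallJ. Qed.

Lemma words_smallJ n x y : words B n x -> words B n (x ^ y).
Proof.
elim: n x => [|n IHn] x /=; first by move=> ->; rewrite conj1g.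
move=> [c [z [Bc Wz ->]]]; exists (c ^ y), (z ^ y); rewrite conjMg.
by split=> //; [exact: BJ|exact: IHn].
Qed.

(** The form in which the gap is used; the longest words that come up have six letters. *)
Lemma comm2_words j c : comm2 c -> words B j c -> j <= 8 -> B c.
Proof. by move=> Cc Wc j8; apply: gap => //; apply/small_words/(words_leq B1 j8). Qed.

Lemma comm2F x y x' y' : comm2 ([~ x, y] / [~ x', y']).
Proof. by exists x, y, y', x'; rewrite invgR. Qed.

Lemma comm2_comm x y : comm2 [~ x, y].
Proof. by exists x, y, 1, 1; rewrite commg1 mulg1. Qed.

Lemma comm2R x y z : comm2 [~ x, y, z].
Proof. by exists y, x, (x ^ z), (y ^ z); rewrite commgEl invgR conjRg. Qed.

Definition almost_fixing : set G := [set z | forall x y, B [~ x, y, z]].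

Lemma almost_fixing_subgroup : is_subgroup almost_fixing.
Proof.
apply: subgroup_intro => [x y|z z' Hz Hz' x y|z Hz x y].
- by rewrite commg1.
- apply: (@comm2_words 2 _ (comm2R _ _ _)) => //.
  have -> : [~ x, y, z * z'] = [~ x, y, z'] * [~ x, y, z] ^ z' by gnormalize.
  by apply: (@words_cat _ _ 1 1); apply: words1 => //; exact: BJ.
- have -> : [~ x, y, z^-1] = ([~ x, y, z]^-1) ^ z^-1 by gnormalize.
  exact/BJ/BV.
Qed.

(** It suffices to watch how [z] moves one commutator [c i] of each colour: any [[~ x, y]] is some
    [c i] up to two letters, so [[~ x, y, z / z']] costs [4 + 2] letters when [c i ^ z] and
    [c i ^ z'] have the same colour. *)
Lemma index_almost_fixing : index_le almost_fixing (k.+1 ^ k.+1).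
Proof.
have /choice[r rP] : forall i, exists xy : G * G, forall x y,
    f [~ x, y] = i -> f [~ xy.1, xy.2] = i.
  move=> i; have [[x [y xyi]]|ni] := pselect (exists x y, f [~ x, y] = i).
    by exists (x, y).
  by exists (1, 1) => x y xyi; case: ni; exists x, y.
pose c i := [~ (r i).1, (r i).2].
apply: (@classes_le_intro _ _ (fun z => [ffun i => f (c i ^ z)])).
  by rewrite card_ffun !card_ord.
move=> z z' _ _ /ffunP e x y; pose i := f [~ x, y].
have := e i; rewrite !ffunE; set w := z / z' => ezz'.
have fci : f (c i) = i by exact: rP.
have W1 : words B 2 ([~ x, y] / c i) by apply: fP => //; exact: comm2_comm.
have W2 : words B 2 (c i ^ z / c i ^ z').
  by apply: fP => //; rewrite /c conjRg; exact: comm2_comm.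
apply: (@comm2_words 6 _ (comm2R _ _ _)) => //.
have -> : [~ x, y, w] = (([~ x, y] / c i)^-1 * ([~ x, y] / c i) ^ w) ^ c i *
    ((c i ^ z / c i ^ z') ^ z'^-1) ^ c i by rewrite /w; gnormalize.
apply: (@words_cat _ _ 4 2); last by do 2 apply: words_smallJ.
by apply: words_smallJ; apply: (@words_cat _ _ 2 2); [exact: wordsV|exact: words_smallJ].
Qed.

Let L : set G := generated B.

Lemma nL : normal_subgroup L.
Proof.
split; first exact: subgroup_generated.
by move=> g; apply: generatedJ => b; exact: BJ.
Qed.

Lemma words_gen n x : words B n x -> L x.
Proof. apply: words_subgroup; [exact: subgroup_generated|exact: sub_generated]. Qed.

(** The [l i] are words of length [m], not arbitrary elements of [L], which puts them in
    [small (N ^ N)]. Nothing is lost: if no word of length [m.+1] gives a new conjugate of [c], the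
    letters map the [c ^ l i] among themselves, hence so does [L]. *)
Lemma exists_max_class : exists a m (l : 'I_m -> G), [/\ comm2 a /\ B a, m <= N,
  forall i, words B m (l i), injective (fun i => a ^ l i) &
  forall c, comm2 c -> B c -> injective (fun i => c ^ l i) ->
    forall g, L g -> exists i, c ^ g = c ^ l i].
Proof.
pose P m := exists a (l : 'I_m -> G), [/\ comm2 a, B a,
  forall i, words B m (l i) & injective (fun i => a ^ l i)].
have comm21 : @comm2 G 1 by exists 1, 1, 1, 1; rewrite commg1 mulg1.
have Pm m : P m -> m <= N.
  move=> [a [l [_ [h hP] _ inj]]].
  have /leq_card : injective (h \o l).
    move=> i j /hP e; apply: inj; have := e I I => /= {2}<-.
    by rewrite -conjgM mulgVK.
  by rewrite !card_ord.
have P0 : P 0 by exists 1, (fun=> 1); split=> // -[].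
have [m [[a [l [Ca Ba Wl inj]]] max]] := nat_maximal P0 Pm.
have mN : m <= N by apply: Pm; exists a, l.
exists a, m, l; split=> // c Cc Bc injc.
have short g : words B m.+1 g -> exists i, c ^ g = c ^ l i.
  move=> Wg; apply: contrapT => ng; apply: max.
  exists c, (fun j => if unlift ord0 j is Some i then l i else g); split=> //.
    by move=> j; case: unliftP => // i _; apply: words_leq (Wl i).
  move=> i j /=; case: (unliftP ord0 i) => [i'|] ->; case: (unliftP ord0 j) => [j'|] -> //.
  - by move=> /injc ->.
  - by move=> e; case: ng; exists i'.
  - by move=> e; case: ng; exists j'.
have stable n g i : words B n g -> exists j, c ^ (l i * g) = c ^ l j.
  elim: n g i => [|n IHn] g i /=; first by move=> ->; exists i; rewrite mulg1.
  move=> [b [h [Bb Wh ->]]].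
  have [|j ej] := short (l i * b).
    by rewrite -addn1; apply: words_cat => //; exact: words1.
  by have [j' ej'] := IHn h j Wh; exists j'; rewrite mulgA conjgM ej -conjgM.
move=> g /(generated_words BV)[n Wg].
have [|j0 ej0] := short 1; first exact: (words_leq B1 (leq0n _) (erefl _ : words B 0 1)).
have [j ej] := stable n g j0 Wg; exists j.
by rewrite -ej conjgM -ej0 conjg1.
Qed.

End Gap.

Lemma factorial_multiple j n : 0 < j -> j <= n -> exists i, (n`! = j * i)%N.
Proof. by move=> j0 jn; exists (n`! %/ j); rewrite mulnC divnK // dvdn_fact // j0. Qed.

Lemma commgM_expand (G : groupType) (v d w e : G) : [~ v * d, w * e] =
  [~ v, e] ^ d * [~ d, e] * [~ v, w] ^ (d * e) * [~ d, w] ^ e.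
Proof. by gnormalize. Qed.

Lemma conj_collect (G : groupType) (a1 a2 p1 r1 q1 p2 r2 q2 : G) :
  p1 * a1 * r1 * q1 * (p2 * a2 * r2 * q2) =
  p1 * (r1 ^ a1^-1 * (q1 ^ a1^-1 * p2 ^ a1^-1) * r2 ^ (a1 * a2)^-1) *
  q2 ^ (a1 * a2)^-1 * (a1 * a2).
Proof. by gnormalize. Qed.

Lemma conj_cancel (G : groupType) (r1 q r2 p q' : G) :
  r1 * r2 = (q ^ r1^-1)^-1 * (p^-1 * (p * (r1 * q * r2) * q') / q').
Proof. by gnormalize. Qed.

(** * A product of two commutators of maximal class *)

Section MaxClass.
Variables (G : groupType) (N k : nat).
Implicit Types (x y z c g h b u v w : G).

Let B : set G := small N.
Let L : set G := generated B.

Hypothesis N0 : 0 < N.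
Hypothesis gap : forall c, comm2 c -> small (N ^ 8) c -> B c.
Hypothesis gapG : comm_gap G N k.

Variables (d1 e1 d2 e2 a1 a : G) (m : nat) (l : 'I_m -> G).
Hypothesis a1E : a1 = [~ d1, e1].
Hypothesis aE : a = [~ d1, e1] * [~ d2, e2].
Hypothesis Ba : B a.
Hypothesis mN : m <= N.
Hypothesis Wl : forall i, words B m (l i).
Hypothesis inj_l : injective (fun i => a ^ l i).
Hypothesis maxP : forall c, comm2 c -> B c -> injective (fun i => c ^ l i) ->
  forall g, L g -> exists i, c ^ g = c ^ l i.

Let B1 : B 1. Proof. exact: small1. Qed.
Let BV x : B x -> B x^-1. Proof. exact: smallV. Qed.
Let BJ x y : B x -> B (x ^ y). Proof. exact: smallJ. Qed.
Let sL : is_subgroup L. Proof. by case: (nL G N). Qed.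
Let LJ g x : L x -> L (x ^ g). Proof. by case: (nL G N) => _; exact. Qed.
Let Ca : comm2 a. Proof. by rewrite aE; exists d1, e1, d2, e2. Qed.

Let aR : set G := [set c | exists g h, L h /\ c = [~ a ^ g, h]].
Let P : set G := generated aR.

Lemma commutators_gen1 : aR 1.
Proof. by exists 1, 1; rewrite commg1; split=> //; exact: subgroup1. Qed.

Lemma commutators_genV c : aR c -> aR c^-1.
Proof.
move=> [g [h [Lh ->]]]; exists (g * h), h^-1; split; first exact: (subgroupV sL).
by gnormalize.
Qed.

Lemma commutators_genJ c y : aR c -> aR (c ^ y).
Proof.
move=> [g [h [Lh ->]]]; exists (g * y), (h ^ y); split; first exact: LJ.
by rewrite conjRg conjgM.
Qed.

Lemma commutators_gen_count : classes_le aR eq (N * N).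
Proof.
have := Ba; rewrite /B /= => Ba'.
have i1 := classes_le_preim (fun p : G * G => p.1) Ba'.
have i2 := classes_le_preim (fun p : G * G => p.2) Ba'.
have i12 : classes_le [set: G * G] (fun p q =>
    (a ^ p.1)^-1 * a ^ p.2 = (a ^ q.1)^-1 * a ^ q.2) (N * N).
  apply: classes_le_sub (classes_leI i1 i2) _ _ _ => // p q _ _ [/= f1 f2].
  have eqJ g h : a ^ (g / h) = a -> a ^ g = a ^ h.
    by move=> e; rewrite -[g](mulgVK h) conjgM e.
  by rewrite (eqJ _ _ f1) (eqJ _ _ f2).
apply: classes_le_sub (classes_le_image (1, 1) i12) _ _ _ => //.
by move=> _ [g [h [_ ->]]]; exists (g, g * h) => //=; rewrite conjgM.
Qed.

(* If [c = [~ x, h]] and [c ^+ q] commutes with [h], then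
   [c ^+ q.+1 = [~ x, h * h] * (c ^ h) ^+ q.-1]. *)
Lemma commutators_gen_exp c : aR c -> words aR (N ^ N)`! (c ^+ ((N ^ N)`!).+1).
Proof.
move=> [g [h0 [Lh0 ec]]].
(* By maximality [h0] may be replaced by a conjugate of some [l i], whose centralizer has index at
   most [N ^ N]. *)
have [i ei] : exists i, a ^ (h0 ^ g^-1) = a ^ l i.
  by apply: maxP => //; exact: LJ.
set x := a ^ g in ec *; pose h := l i ^ g.
have Lh : L h by apply: LJ; exact: words_gen (Wl i).
have {}ec : c = [~ x, h].
  rewrite ec !commgEl /x /h; congr (_ * _).
  rewrite -conjJg -ei -!conjgM; congr (a ^ _); by gnormalize.
have Bh : small (N ^ N) h.
  apply: smallJ; apply: small_sub (small_words (Wl i)).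
  by apply: leq_pexp2l.
(* Two powers of [c] with exponents up to [N ^ N] lie in the same coset of the centralizer of [h],
   so [h] commutes with a power whose exponent divides the factorial. *)
have [//|s [t [st tN _ ch]]] := classes_le_pigeonhole (x := fun j => c ^+ j) Bh.
have [q eq] : exists q, ((N ^ N)`! = (t - s) * q)%N.
  by apply: factorial_multiple; rewrite ?subn_gt0 // (leq_trans (leq_subr _ _)).
set Q := ((N ^ N)`!)%N in eq *.
have Q0 : 0 < Q by exact: fact_gt0.
have cQ : commute h (c ^+ Q).
  rewrite eq expgnA; apply: commuteX; apply/commgP/conjg_fixP.
  by rewrite expgnFr ?(ltnW st).
have aRch : aR (c ^ h) by apply: commutators_genJ; rewrite ec; exists g, h.
have aRh2 : aR [~ x, h * h] by exists g, (h * h); split=> //; exact: (subgroupM sL).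
move: x h ec cQ aRch aRh2 {Lh Bh ch ei} => x h ec cQ aRch aRh2.
have -> : c ^+ Q.+1 = [~ x, h * h] * (c ^ h) ^+ Q.-1.
  rewrite -conjXg expgS {1}ec; move: cQ; rewrite -(prednK Q0) expgS.
  set r := c ^+ _ => cQ /=.
  have -> : [~ x, h] * (c * r) = x^-1 * h^-1 * x * (h * (c * r)) by gnormalize.
  by rewrite cQ ec; move: r {cQ} => r; gnormalize.
rewrite -[X in words _ X](prednK Q0) -add1n; apply: words_cat.
  exact: words1.
elim: Q.-1 => [//|j IHj]; rewrite expgS -add1n.
by apply: words_cat => //; exact: words1.
Qed.

Definition commutators_bound := ((N * N) ^ (N * N * (N ^ N)`!))%N.

Lemma commutators_bounded : classes_le P eq commutators_bound.
Proof.
apply: generated_classes_le.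
- exact: commutators_gen1.
- exact: commutators_genV.
- by move=> x y Xx _; exact: commutators_genJ.
- exact: commutators_gen_count.
- exact: commutators_gen_exp.
Qed.

Lemma commutators_normal : normal_subgroup P.
Proof.
split; first exact: subgroup_generated.
by move=> g; apply: generatedJ => c; exact: commutators_genJ.
Qed.

Let sP : is_subgroup P. Proof. by case: commutators_normal. Qed.
Let PJ g x : P x -> P (x ^ g). Proof. by case: commutators_normal => _; exact. Qed.

Definition cent_mod (Q : set G) : set G := [set g | forall h, L h -> Q [~ g, h]].

Let C : set G := cent_mod P.

Lemma cent_mod_normal (Q : set G) : normal_subgroup Q -> normal_subgroup (cent_mod Q).
Proof.
move=> [sQ QJ]; split.
  apply: subgroup_intro => [h Lh|g g' Cg Cg' h Lh|g Cg h Lh].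
  - by rewrite comm1g; exact: subgroup1.
  - have -> : [~ g * g', h] = [~ g, h] ^ g' * [~ g', h] by gnormalize.
    by apply: (subgroupM sQ); [apply: QJ; exact: Cg|exact: Cg'].
  - have -> : [~ g^-1, h] = ([~ g, h]^-1) ^ g^-1 by gnormalize.
    by apply: QJ; apply: (subgroupV sQ); exact: Cg.
move=> y g Cg h Lh; have -> : [~ g ^ y, h] = [~ g, h ^ y^-1] ^ y by gnormalize.
by apply: QJ; apply: Cg; exact: LJ.
Qed.

Let sC : is_subgroup C. Proof. by case: (cent_mod_normal commutators_normal). Qed.
Let CJ g x : C x -> C (x ^ g).
Proof. by case: (cent_mod_normal commutators_normal) => _; exact. Qed.

(* [a] has as many conjugates as possible and [r] commutes with the elements
   providing them, so that [(r * a) ^ h = r * a ^ l i] for some [i]. *)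
Lemma max_class_cent r : (forall i, l i ^ r = l i) -> comm2 (r * a) -> B (r * a) -> C r.
Proof.
move=> rl Cra Bra h Lh.
have rlJ i : (r * a) ^ l i = r * a ^ l i.
  rewrite conjMg; congr (_ * _); apply/conjg_fixP; rewrite commg1_sym.
  by apply/conjg_fixP.
have [|i ei] := maxP Cra Bra _ Lh.
  by move=> i j; rewrite !rlJ => /mulgI; exact: inj_l.
have -> : [~ r, h] = ([~ a, l i] / [~ a, h]) ^ a^-1.
  have -> : [~ r, h] = r^-1 * (r * a) ^ h / a ^ h by gnormalize.
  by rewrite ei rlJ; gnormalize.
have Pa x : L x -> P [~ a, x].
  by move=> Lx; apply: sub_generated; exists 1, x; rewrite conjg1.
exact: (PJ _ (subgroupF sP (Pa _ (words_gen (Wl i))) (Pa _ Lh))).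
Qed.

Let Z : set G := [set g | forall c, range l c -> c ^ g = c].

Let sZ : is_subgroup Z. Proof. exact: subgroup_cent. Qed.

Let U : set G := core Z.

Let sU : is_subgroup U. Proof. exact: core_subgroup. Qed.

Lemma index_range_cent : index_le Z ((N ^ N) ^ N).
Proof.
have Bl i : index_le [set g | l i ^ g = l i] (N ^ N).
  by apply: small_sub (small_words (Wl i)); apply: leq_pexp2l.
apply: classes_le_sub (classes_le_forall Bl) _ _ _ => //.
  by move=> g h _ _ ghl _ [i _ <-]; exact: ghl.
by rewrite card_ord; apply: leq_pexp2l; rewrite // expn_gt0 N0.
Qed.

Let Hs : set G := small_cent N d1 `&` small_cent N e1 `&`
  (small_cent N d2 `&` small_cent N e2).

Let sHs : is_subgroup Hs.
Proof. by do 2 (apply: subgroupI); apply: (small_cent_subgroup gapG). Qed.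

(** The core makes [W] normal, so that its elements can be conjugated beforehand to cancel
    conjugations by the entries of [a]. *)
Let W : set G := core (Z `&` Hs).

Definition class_index_bound :=
  let b := ((N ^ N) ^ N * ((k.+1 * k.+1) * (k.+1 * k.+1)))%N in (b ^ b)%N.

Lemma index_class_cent : index_le W class_index_bound.
Proof.
apply: index_le_core; first exact: subgroupI.
apply: index_leI; first exact: index_range_cent.
by do 2 (apply: index_leI); apply: (index_small_cent gapG).
Qed.

Let WJ g x : W x -> W (x ^ g). Proof. exact: coreJ. Qed.

Let WU : W `<=` U.
Proof. by move=> g Wg h; case: (Wg h). Qed.

Let UJ g x : U x -> U (x ^ g). Proof. exact: coreJ. Qed.

Let UR v x : U v -> U [~ v, x].
Proof. by move=> Uv; apply: (subgroupM sU); [exact: (subgroupV sU)|exact: UJ]. Qed.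

Let URr v x : U v -> U [~ x, v].
Proof. by move=> /(UR x)/(subgroupV sU); rewrite invgR. Qed.

Let max_class_centU r : U r -> comm2 (r * a) -> words B 8 (r * a) -> C r.
Proof.
move=> Ur Cra Wra; apply: max_class_cent => //.
  by move=> i; apply: (core_sub Ur); exists i.
exact: (comm2_words N0 gap Cra Wra).
Qed.

Let W_smallP v : W v -> [/\ B [~ v, d1], B [~ v, e1], B [~ v, d2] & B [~ v, e2]].
Proof.
by move=> /core_sub[_ [[? ?] [? ?]]]; split; apply: small_centC.
Qed.

Let words2a r : B r -> words B 8 (r * a).
Proof.
by move=> Br; apply: (words_leq B1 (n := 2)) => //; exists r, a; split=> //; exact: words1.
Qed.

(** Replacing [d1] by [v * d1] multiplies [a] on the left by [[~ v, e1] ^ d1], an element of B, so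
    [max_class_cent] applies. The other three entries are treated in the same way below. *)
Let cent_e1 v : W v -> C ([~ v, e1] ^ d1).
Proof.
move=> Wv; have [_ Be _ _] := W_smallP Wv.
apply: max_class_centU; [by apply/UJ/UR/WU| |by apply/words2a/BJ].
by exists (v * d1), e1, d2, e2; rewrite aE; gnormalize.
Qed.

Let cent_d1 v : W v -> C ([~ d1, v] ^ (e1 * a1^-1)).
Proof.
move=> Wv; have [Bd _ _ _] := W_smallP Wv.
apply: max_class_centU; [by apply/UJ/URr/WU| |].
  by exists d1, (v * e1), d2, e2; rewrite aE a1E; gnormalize.
by apply/words2a/BJ; rewrite -invgR; exact: BV.
Qed.

Let cent_e2 v : W v -> C ([~ v, e2] ^ (d2 * a1^-1)).
Proof.
move=> Wv; have [_ _ _ Be] := W_smallP Wv.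
apply: max_class_centU; [by apply/UJ/UR/WU| |by apply/words2a/BJ].
by exists d1, e1, (v * d2), e2; rewrite aE a1E; gnormalize.
Qed.

Let cent_d2 v : W v -> C ([~ d2, v] ^ (e2 * a^-1)).
Proof.
move=> Wv; have [_ _ Bd _] := W_smallP Wv.
apply: max_class_centU; [by apply/UJ/URr/WU| |].
  by exists d1, e1, d2, (v * e2); rewrite aE; gnormalize.
by apply/words2a/BJ; rewrite -invgR; exact: BV.
Qed.

(** All four entries of [a] are replaced at once. The result is [r * a], where besides [[~ v, w]]
    and [[~ v', w']] the element [r] has only the factors [p], [q], [q'], already known to be in
    [C]. *)
Lemma small_comm2_cent v w v' w' : W v -> W w -> W v' -> W w' ->
  B ([~ v, w] * [~ v', w']) -> C ([~ v, w] * [~ v', w']).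
Proof.
move=> Wv Ww Wv' Ww' Bvw.
(* Chosen so that the conjugations produced by the expansion turn [[~ v1, w1]] into [[~ v, w]] and
   [[~ v2, w2]] into [[~ v', w']]. *)
pose h1 := (d1 * e1 * a1^-1)^-1; pose h2 := (d2 * e2 * a^-1)^-1.
pose v1 := v ^ h1; pose w1 := w ^ h1; pose v2 := v' ^ h2; pose w2 := w' ^ h2.
have [Wv1 Ww1 Wv2 Ww2] : [/\ W v1, W w1, W v2 & W w2] by split; exact: WJ.
pose p := [~ v1, e1] ^ d1.
pose q := ([~ d1, w1] ^ (e1 * a1^-1)) * ([~ v2, e2] ^ (d2 * a1^-1)).
pose q' := [~ d2, w2] ^ (e2 * a^-1).
pose R := [~ v, w]; pose R' := [~ v', w'].
pose r := p * (R * q * R') * q'.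
have Cp : C p by exact: cent_e1.
have Cq : C q by apply: (subgroupM sC); [exact: cent_d1|exact: cent_e2].
have Cq' : C q' by exact: cent_d2.
have [_ Bp1 _ _] := W_smallP Wv1; have [Bw1 _ _ _] := W_smallP Ww1.
have [_ _ _ Bv2] := W_smallP Wv2; have [_ _ Bw2 _] := W_smallP Ww2.
have Cr : C r.
  apply: max_class_centU.
  - have Up : U p by apply: UJ; apply: UR; exact: WU.
    have Uq' : U q' by apply: UJ; apply: URr; exact: WU.
    have Uq1 : U ([~ d1, w1] ^ (e1 * a1^-1)) by apply: UJ; apply: URr; exact: WU.
    have Uq2 : U ([~ v2, e2] ^ (d2 * a1^-1)) by apply: UJ; apply: UR; exact: WU.
    have UR1 : U R by apply: UR; exact: WU.
    have UR' : U R' by apply: UR; exact: WU.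
    have Uq := subgroupM sU Uq1 Uq2.
    exact: (subgroupM sU (subgroupM sU Up (subgroupM sU (subgroupM sU UR1 Uq) UR')) Uq').
  - exists (v1 * d1), (w1 * e1), (v2 * d2), (w2 * e2).
    have aE' : a = a1 * [~ d2, e2] by rewrite a1E.
    rewrite (commgM_expand v1 d1 w1 e1) (commgM_expand v2 d2 w2 e2) conj_collect -a1E -aE' -!conjgM /r /p /q /q'.
    have -> : [~ v1, w1] ^ (d1 * e1 * a1^-1) = R.
      by rewrite -[_ * _]invgK -/h1 /v1 /w1 -conjRg conjgK.
    have -> : [~ v2, w2] ^ (d2 * e2 * a^-1) = R'.
      by rewrite -[_ * _]invgK -/h2 /v2 /w2 -conjRg conjgK.
    by [].
  - apply: (words_leq B1 (n := 1 + (2 + 1) + 1 + 1)) => //.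
    apply: words_cat; last exact: words1.
    apply: words_cat; last by apply: words1; apply: BJ; rewrite -invgR; exact: BV.
    apply: words_cat; first by apply/words1/BJ.
    (* Only the product of [R] and [R'] is known to be in B, so they are brought together. *)
    have -> : R * q * R' = q ^ R^-1 * (R * R') by gnormalize.
    apply: words_cat; last exact: words1.
    apply: words_smallJ; apply: (@words_cat _ _ 1 1); apply/words1/BJ => //.
    by rewrite -invgR; exact: BV.
have -> : R * R' = (q ^ R^-1)^-1 * (p^-1 * r / q').
  exact: conj_cancel.
have Cpr := subgroupF sC (subgroupM sC (subgroupV sC Cp) Cr) Cq'.
exact: (subgroupM sC (subgroupV sC (CJ _ Cq)) Cpr).
Qed.

End MaxClass.

Section Reduction.
Variables (G : groupType) (N k : nat) (f : G -> 'I_k.+1).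
Implicit Types (x y z c g h b u v w p : G) (V : set G).

Let B : set G := small N.
Let L : set G := generated B.

Hypothesis N0 : 0 < N.
Hypothesis gap : forall c, comm2 c -> small (N ^ 8) c -> B c.
Hypothesis fP : forall c c', comm2 c -> comm2 c' -> f c = f c' ->
  words B 2 (c / c').
Hypothesis gapG : comm_gap G N k.

Lemma small_comm2_mod : exists P W : set G,
  [/\ normal_subgroup P, classes_le P eq (commutators_bound N),
      is_subgroup W, index_le W (class_index_bound N k) &
      forall v w v' w', W v -> W w -> W v' -> W w' ->
        B ([~ v, w] * [~ v', w']) -> cent_mod N P ([~ v, w] * [~ v', w'])].
Proof.
have [a [m [l [[Ca Ba] mN Wl inj maxP]]]] := exists_max_class G N0.
have [d1 [e1 [d2 [e2 aE]]]] := Ca.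
exists (generated [set c | exists g h, L h /\ c = [~ a ^ g, h]]).
exists (core ([set g | forall c, range l c -> c ^ g = c]
   `&` (small_cent N d1 `&` small_cent N e1
        `&` (small_cent N d2 `&` small_cent N e2)))); split.
- exact: commutators_normal.
- exact: (commutators_bounded N0 aE Ba mN Wl inj maxP).
- apply: core_subgroup; apply: subgroupI; first exact: subgroup_cent.
  by do 2 (apply: subgroupI); apply: (small_cent_subgroup gapG).
- exact: (index_class_cent N0 gapG).
- move=> v w v' w' Wv Ww Wv' Ww'.
  exact: (small_comm2_cent N0 gap (erefl _) aE Ba Wl inj maxP Wv Ww Wv' Ww').
Qed.

(** * Commutators of a robust subgroup *)

Definition comm_classes V : pred 'I_k.+1 :=
  [pred i | `[< exists x y, [/\ V x, V y & f [~ x, y] = i] >]].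

Definition robust V := forall b x y, B b -> V x -> V y ->
  exists x' y', [/\ V x', V y', b ^ x' = b, b ^ y' = b & f [~ x', y'] = f [~ x, y]].

(** As long as [V] is not robust, the centralizer in [V] of some element of B loses a colour of
    commutators; this can happen at most [k.+1] times, each time at the price of a factor [N]. *)
Lemma exists_robust V n : is_subgroup V -> index_le V n ->
  exists V', [/\ is_subgroup V', V' `<=` V, index_le V' (n * N ^ k.+1) & robust V'].
Proof.
suff: forall t V n, #|comm_classes V| <= t -> is_subgroup V -> index_le V n ->
  exists V', [/\ is_subgroup V', V' `<=` V, index_le V' (n * N ^ t) & robust V'].
  by move=> W; apply: W; rewrite -[X in _ <= X]card_ord max_card.
elim=> [|t IHt] {}V {}n Vt sV iV.
  have V1 := subgroup1 sV; move: Vt; rewrite leqn0 => /eqP/card0_eq/(_ (f [~ 1, 1])).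
  by rewrite !inE => /negbT/asboolPn[]; exists 1, 1.
have [rV|] := pselect (robust V).
  exists V; split=> //; apply: index_le_sub iV _ _ => //.
  by rewrite leq_pmulr // expn_gt0 N0.
move=> /existsNP[b /existsNP[x /existsNP[y]]].
move=> /not_implyP[Bb /not_implyP[Vx /not_implyP[Vy nV]]].
pose V' := V `&` [set g | b ^ g = b].
have sV' : is_subgroup V' by apply: subgroupI => //; exact: subgroup_cent1.
have [|||V2 [sV2 V2V' iV2 rV2]] := IHt V' (n * N)%N.
- rewrite -ltnS; apply: leq_trans Vt; apply/proper_card/properP; split.
    apply/fintype.subsetP => i; rewrite !inE => -[x' [y' [[Vx' _] [Vy' _] e]]].
    by exists x', y'.
  exists (f [~ x, y]); first by rewrite inE; exists x, y.
  apply/negP; rewrite inE => -[x' [y' [[Vx' bx'] [Vy' by'] e]]].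
  by apply: nV; exists x', y'.
- exact: sV'.
- exact: index_leI.
- exists V2; split=> //; first by move=> g /V2V'[].
  by rewrite expnS mulnA.
Qed.

Section Robust.
Variables P V : set G.
Hypothesis nP : normal_subgroup P.
Hypothesis sV : is_subgroup V.
Hypothesis PV : forall v w v' w', V v -> V w -> V v' -> V w' ->
  B ([~ v, w] * [~ v', w']) -> cent_mod N P ([~ v, w] * [~ v', w']).
Hypothesis rV : robust V.
Hypothesis fixV : V `<=` almost_fixing N.

Let sP : is_subgroup P. Proof. by case: nP. Qed.
Let PJ g x : P x -> P (x ^ g). Proof. by case: nP => _; exact. Qed.
Let C : set G := cent_mod N P.
Let nC : normal_subgroup C. Proof. exact: cent_mod_normal. Qed.

Lemma same_class_small x y x' y' : f [~ x, y] = f [~ x', y'] ->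
  B ([~ x, y] / [~ x', y']).
Proof.
move=> e; apply: (comm2_words N0 gap (j := 2)) => //; first exact: comm2F.
by apply: fP => //; exact: comm2_comm.
Qed.

(* For [b] in [B], the commutator of [x] and [y] agrees modulo [cent_mod N P] with
   a commutator of elements centralizing [b]. *)
Lemma comm_cent_mod x y : V x -> V y -> C [~ x, y].
Proof.
move=> Vx Vy h; apply: (@generated_sub _ _ [set h | P [~ [~ x, y], h]]).
  apply: subgroup_intro => [|g g' /= Pg Pg'|g /= Pg].
  - by rewrite /= commg1; exact: subgroup1.
  - have -> : [~ [~ x, y], g * g'] = [~ [~ x, y], g'] * [~ [~ x, y], g] ^ g'.
      by move: [~ x, y] {Pg Pg'} => c; gnormalize.
    exact: (subgroupM sP Pg' (PJ _ Pg)).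
  - have -> : [~ [~ x, y], g^-1] = ([~ [~ x, y], g]^-1) ^ g^-1.
      by move: [~ x, y] {Pg} => c; gnormalize.
    exact: (PJ _ (subgroupV sP Pg)).
move=> b Bb /=; have [x' [y' [Vx' Vy' bx' by' e]]] := rV Bb Vx Vy.
have Bxy : B ([~ x, y] / [~ x', y']) by exact: same_class_small.
have Cxy : C ([~ x, y] / [~ x', y']).
  by rewrite invgR; apply: PV => //; rewrite -(invgR x' y').
have b' : [~ [~ x', y'], b] = 1.
  have /conjg_fixP/eqP e1 : b ^ [~ x', y'] = b.
    exact: (subgroupR (subgroup_cent1 b) bx' by').
  by rewrite -(invgR b [~ x', y']) e1 invg1.
have -> : [~ [~ x, y], b] = [~ [~ x, y] / [~ x', y'], b] ^ [~ x', y'] * [~ [~ x', y'], b].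
  by move: [~ x, y] [~ x', y'] {e b' Bxy Cxy} => c c'; gnormalize.
by rewrite b' mulg1; apply: PJ; apply: Cxy; exact: sub_generated.
Qed.

(** [c / c'] and [d / d'] lie in B, which the commutators of [V] centralize modulo [P]. *)
Lemma eqmod_comm_comm x y z t x' y' z' t' :
  V x -> V y -> V z -> V t -> V x' -> V y' -> V z' -> V t' ->
  f [~ x, y] = f [~ x', y'] -> f [~ z, t] = f [~ z', t'] ->
  eqmod P [~ [~ x, y], [~ z, t]] [~ [~ x', y'], [~ z', t']].
Proof.
move=> Vx Vy Vz Vt Vx' Vy' Vz' Vt' /same_class_small Bxy /same_class_small Bzt.
move: (comm_cent_mod Vx Vy) (comm_cent_mod Vx' Vy') (comm_cent_mod Vz Vt) (comm_cent_mod Vz' Vt') Bxy Bzt.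
move: [~ x, y] [~ x', y'] [~ z, t] [~ z', t'] => c c' d d' Cc Cc' Cd Cd' Bcc Bdd.
apply: (eqmod_trans nP (h := [~ c', d])).
  have -> : [~ c, d] = [~ c / c', d] ^ c' * [~ c', d] by gnormalize.
  rewrite -[X in eqmod P _ X]mul1g; apply: eqmodM => //; last exact: eqmod_refl.
  apply/(eqmod1 nP); apply: PJ; apply: commP_sym => //.
  by apply: Cd; exact: sub_generated.
have -> : [~ c', d] = [~ c', d'] * [~ c', d / d'] ^ d' by gnormalize.
rewrite -[X in eqmod P _ X]mulg1; apply: eqmodM => //; first exact: eqmod_refl.
apply/(eqmod1 nP); apply: PJ.
by apply: Cc'; exact: sub_generated.
Qed.

(** [[~ z, t ^+ i]] is a power of [[~ z, t]] up to factors [[~ z, t ^+ j, t]], which lie in B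
    because [V] is inside [almost_fixing N]; [c] centralizes these modulo [P]. *)
Lemma eqmod_comm_exp x y z t i : V x -> V y -> V z -> V t ->
  eqmod P [~ [~ x, y], [~ z, t ^+ i]] ([~ [~ x, y], [~ z, t]] ^+ i).
Proof.
move=> Vx Vy Vz Vt; have Vti j : V (t ^+ j).
  elim: j => [|j IHj]; first exact: subgroup1.
  by rewrite expgS; exact: (subgroupM sV).
have Cc := comm_cent_mod Vx Vy; set c := [~ x, y].
have Lcd : L [~ c, [~ z, t]].
  by apply: sub_generated; apply: (fixV (subgroupR sV Vz Vt)).
elim: i => [|i IHi]; first by rewrite !expg0 !commg1; exact: eqmod_refl.
have Cu := comm_cent_mod Vz (Vti i).
have Lb : L [~ [~ z, t ^+ i], t] by apply: sub_generated; exact: fixV.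
have -> : [~ z, t ^+ i.+1] = [~ z, t] * [~ z, t ^+ i] * [~ [~ z, t ^+ i], t].
  by rewrite expgSr; move: (t ^+ i) => s; gnormalize.
rewrite expgSr.
move: [~ z, t] [~ z, t ^+ i] [~ [~ z, t ^+ i], t] Lcd Lb IHi Cu => d u b Lcd Lb IHi Cu.
have -> : [~ c, d * u * b] = [~ c, b] * ([~ c, u] * [~ c, d] ^ u) ^ b by gnormalize.
rewrite -[X in eqmod P _ X]mul1g; apply: eqmodM => //.
  by apply/(eqmod1 nP); exact: Cc.
apply: (eqmod_trans nP (h := [~ c, u] * [~ c, d] ^ u)).
  apply: eqmod_conj => //.
  have -> : [~ c, u] * [~ c, d] ^ u = [~ c, d * u] by gnormalize.
  have [sC CJ] := nC; have CC : C [~ c, d * u].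
    by rewrite commgEl; apply: (subgroupM sC); [exact: (subgroupV sC)|exact: CJ].
  exact: CC.
apply: eqmodM => //; apply: eqmod_conj => //; apply: commP_sym => //.
exact: Cu.
Qed.

(** Some power of [t] with exponent at most [k.+1] lies in [small_cent N z], and [[~ x, y]]
    centralizes B modulo [P]. *)
Lemma comm_comm_torsion x y z t : V x -> V y -> V z -> V t ->
  exists2 j, 0 < j <= k.+1 & P ([~ [~ x, y], [~ z, t]] ^+ j).
Proof.
move=> Vx Vy Vz Vt.
have [//|i [j [ij jk _ Hij]]] := classes_le_pigeonhole (x := fun i => t ^+ i)
  (index_small_cent gapG z).
exists (j - i); first by rewrite subn_gt0 ij (leq_trans (leq_subr _ _)).
apply/(eqmod1 nP); apply: (eqmod_trans nP (h := [~ [~ x, y], [~ z, t ^+ (j - i)]])).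
  by apply: eqmod_sym => //; exact: eqmod_comm_exp.
apply/(eqmod1 nP); apply: (comm_cent_mod Vx Vy); apply: sub_generated.
by rewrite expgnFr // ltnW.
Qed.

Variable r : nat.
Hypothesis Pr : classes_le P eq r.

(** The factor [p] makes the set closed under inverses and puts every element of [P] lying in [V]
    into it; this turns torsion modulo [P] into the power condition for shortening words. *)
Let X : set G := [set c | exists x y z t p,
  [/\ V x /\ V y, V z /\ V t, P p, V p & c = [~ [~ x, y], [~ z, t]] * p]].

Lemma second_derived_count : classes_le X eq (k.+1 * k.+1 * r).
Proof.
have [h hP] := Pr.
have /choice[rep repP] : forall ij : 'I_k.+1 * 'I_k.+1, exists s, forall x y z t,
    V x -> V y -> V z -> V t -> f [~ x, y] = ij.1 -> f [~ z, t] = ij.2 ->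
    eqmod P s [~ [~ x, y], [~ z, t]].
  move=> [i j].
  have [[x [y [z [t [[Vx Vy] [Vz Vt] <- <-]]]]]|nij] := pselect (exists x y z t,
      [/\ V x /\ V y, V z /\ V t, f [~ x, y] = i & f [~ z, t] = j]).
    exists [~ [~ x, y], [~ z, t]] => x' y' z' t' Vx' Vy' Vz' Vt' /= e1 e2.
    by apply: eqmod_comm_comm.
  exists 1 => x y z t Vx Vy Vz Vt /= e1 e2; case: nij.
  by exists x, y, z, t.
have /choice[ij ijP] : forall c, exists ij : 'I_k.+1 * 'I_k.+1, X c -> P ((rep ij)^-1 * c).
  move=> c; have [[x [y [z [t [p [[Vx Vy] [Vz Vt] Pp Vp ->]]]]]]|nX] := pselect (X c).
    exists (f [~ x, y], f [~ z, t]) => _; rewrite mulgA; apply: (subgroupM sP _ Pp).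
    exact: repP.
  by exists (ord0, ord0) => Xc; case: nX.
apply: (@classes_le_intro _ _ (fun c => (ij c, h ((rep (ij c))^-1 * c)))).
  by rewrite !card_prod !card_ord.
move=> c c' Xc Xc' [eij]; rewrite eij => /hP e.
apply: (mulgI (rep (ij c'))^-1); apply: e; last exact: ijP.
by rewrite -eij; exact: ijP.
Qed.

Lemma sub_second_derived c : X c -> V c.
Proof.
move=> [x [y [z [t [p [[Vx Vy] [Vz Vt] Pp Vp ->]]]]]].
by apply: (subgroupM sV) => //; apply: (subgroupR sV); exact: (subgroupR sV).
Qed.

Lemma second_derivedJ c g : V g -> X c -> X (c ^ g).
Proof.
move=> Vg [x [y [z [t [p [[Vx Vy] [Vz Vt] Pp Vp ->]]]]]].
have VJ u : V u -> V (u ^ g) by move=> Vu; exact: (subgroupJ sV).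
exists (x ^ g), (y ^ g), (z ^ g), (t ^ g), (p ^ g); split.
- by split; exact: VJ.
- by split; exact: VJ.
- exact: PJ.
- exact: VJ.
- by rewrite conjMg !conjRg.
Qed.

Lemma second_derived_exp c : X c -> words X (k.+2)`! (c ^+ ((k.+2)`!).+1).
Proof.
move=> Xc; have [x [y [z [t [p [[Vx Vy] [Vz Vt] Pp Vp ec]]]]]] := Xc.
have X0 p' : P p' -> V p' -> X p'.
  have V1 := subgroup1 sV.
  by exists 1, 1, 1, 1, p'; split=> //; rewrite !commg1 mul1g.
have [j /andP[j0 jk] Pj] := comm_comm_torsion Vx Vy Vz Vt.
have [q eq] : exists q, ((k.+2)`! = j * q)%N by apply: factorial_multiple => //; exact: leqW.
have Vc : V c by exact: sub_second_derived.
have VX n : V (c ^+ n).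
  elim: n => [|n IHn]; first exact: subgroup1.
  by rewrite expgS; exact: (subgroupM sV).
have Xq : X (c ^+ (k.+2)`!).
  apply: X0 => //; apply/(eqmod1 nP); rewrite eq expgnA -(expg1n _ q).
  apply: eqmodX => //; apply: (eqmod_trans nP (h := [~ [~ x, y], [~ z, t]] ^+ j)).
    apply: eqmodX => //; rewrite ec -[X in eqmod P _ X]mulg1.
    by apply: eqmodM => //; [exact: eqmod_refl|exact/(eqmod1 nP)].
  exact/(eqmod1 nP).
have X1 : X 1 by apply: X0; exact: subgroup1.
(* The factorial of [k.+2] is at least 2 even for [k = 0], which leaves room for two letters. *)
apply: (words_leq X1 (n := 2)); first by rewrite factS; exact: leq_trans (leq_pmulr _ (fact_gt0 _)).
by rewrite expgS; exists c, (c ^+ (k.+2)`!); split=> //; exact: words1.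
Qed.

Lemma second_derived_bounded :
  classes_le (generated X) eq
    ((k.+1 * k.+1 * r) ^ (k.+1 * k.+1 * r * (k.+2)`!)).
Proof.
apply: generated_classes_le.
- exists 1, 1, 1, 1, 1; have V1 := subgroup1 sV.
  by split=> //; [exact: subgroup1|rewrite !commg1 mulg1].
- move=> c [x [y [z [t [p [[Vx Vy] [Vz Vt] Pp Vp ->]]]]]].
  exists z, t, x, y, (p^-1 ^ [~ [~ z, t], [~ x, y]]).
  have Vc : V [~ [~ z, t], [~ x, y]] by apply: (subgroupR sV); exact: (subgroupR sV).
  split=> //; first by apply: PJ; exact: subgroupV.
    exact: (subgroupJ sV (subgroupV sV Vp) Vc).
  by rewrite invgM (invgR [~ x, y]) -conjgC.
- by move=> c g Xc Xg; apply: second_derivedJ => //; exact: sub_second_derived.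
- exact: second_derived_count.
- exact: second_derived_exp.
Qed.

Lemma second_derived_section : exists Q, [/\ is_subgroup Q, Q `<=` V,
  forall g c, V g -> Q c -> Q (c ^ g),
  classes_le Q eq ((k.+1 * k.+1 * r) ^ (k.+1 * k.+1 * r * (k.+2)`!)) &
  forall x y z t, V x -> V y -> V z -> V t -> Q [~ [~ x, y], [~ z, t]]].
Proof.
exists (generated X); split.
- exact: subgroup_generated.
- by apply: generated_sub => // c; exact: sub_second_derived.
- by move=> g c Vg; apply: generatedJ => x; exact: second_derivedJ.
- exact: second_derived_bounded.
- move=> x y z t Vx Vy Vz Vt; apply: sub_generated.
  by exists x, y, z, t, 1; split=> //; [exact: subgroup1|exact: subgroup1|rewrite mulg1].
Qed.

End Robust.

Definition section_bound := (class_index_bound N k * k.+1 ^ k.+1 * N ^ k.+1 +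
  let r := k.+1 * k.+1 * commutators_bound N in r ^ (r * (k.+2)`!))%N.

Lemma exists_metabelian_section : exists V Q : set G,
  [/\ is_subgroup V /\ index_le V section_bound,
      is_subgroup Q /\ Q `<=` V,
      forall g c, V g -> Q c -> Q (c ^ g),
      classes_le Q eq section_bound &
      forall x y z t, V x -> V y -> V z -> V t -> Q [~ [~ x, y], [~ z, t]]].
Proof.
have [P [W [nP Pr sW iW PW]]] := small_comm2_mod.
have [||V [sV VW iV rV]] := @exists_robust (W `&` almost_fixing N)
    (class_index_bound N k * k.+1 ^ k.+1)%N.
- by apply: subgroupI => //; exact: almost_fixing_subgroup.
- by apply: index_leI => //; exact: (index_almost_fixing N0 gap fP).
have [|v Vv|Q [sQ QV QJ Qb VQ]] := second_derived_section nP sV _ rV _ Pr.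
- move=> v w v' w' /VW[Wv _] /VW[Ww _] /VW[Wv' _] /VW[Ww' _]; exact: PW.
- by have [] := VW v Vv.
exists V, Q; split=> //.
- by split=> //; apply: index_le_sub iV _ _ => //; exact: leq_addr.
- by apply: classes_le_sub Qb _ _ _ => //; exact: leq_addl.
Qed.

End Reduction.

(** * Sections of a group *)

Section SectionGroup.
Variables (G : groupType) (V Q : set G).
Hypothesis sV : is_subgroup V.
Hypothesis sQ : is_subgroup Q.
Hypothesis QJ : forall g c, V g -> Q c -> Q (c ^ g).
Implicit Types x y z : G.

Definition coset_rep x := xget 1 [set y | V y /\ Q (x^-1 * y)].

Lemma coset_repP x : V x -> V (coset_rep x) /\ Q (x^-1 * coset_rep x).
Proof.
move=> Vx; apply: (@xgetPex _ 1 [set y | V y /\ Q (x^-1 * y)]); exists x.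
by split=> //; rewrite mulVg; exact: subgroup1.
Qed.

Lemma coset_rep_eq x y : V x -> V y -> Q (x^-1 * y) <-> coset_rep x = coset_rep y.
Proof.
move=> Vx Vy; split=> [Qxy|e].
  congr (xget 1 _); apply/seteqP; split=> z [Vz Qz]; split=> //.
    by have := subgroupM sQ (subgroupV sQ Qxy) Qz; gnormalize.
  by have := subgroupM sQ Qxy Qz; gnormalize.
have [_ Qx] := coset_repP Vx; have [_] := coset_repP Vy; rewrite -e => Qy.
by have := subgroupM sQ Qx (subgroupV sQ Qy); gnormalize.
Qed.

(* The section [V / Q], each coset being represented by its canonical element. *)
Record section_group := SectionGroup {
  section_val :> G;
  section_valP : V section_val /\ coset_rep section_val = section_val }.

Lemma section_inj (u v : section_group) : section_val u = section_val v -> u = v.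
Proof.
case: u v => [x px] [y py] /= e; rewrite e in px *.
by congr SectionGroup; exact: Prop_irrelevance.
Qed.

HB.instance Definition _ := gen_eqMixin section_group.
HB.instance Definition _ := gen_choiceMixin section_group.

Lemma coset_rep_valP x : V x ->
  V (coset_rep x) /\ coset_rep (coset_rep x) = coset_rep x.
Proof.
move=> Vx; have [Vr Qr] := coset_repP Vx; split=> //.
by apply/esym/coset_rep_eq.
Qed.

Definition section_of x (Vx : V x) := SectionGroup (coset_rep_valP Vx).

Lemma section_of_eq x y (Vx : V x) (Vy : V y) :
  Q (x^-1 * y) <-> section_of Vx = section_of Vy.
Proof.
rewrite coset_rep_eq //; split=> [e|[]//]; exact: section_inj.
Qed.

Let valV (u : section_group) : V u. Proof. by case: (section_valP u). Qed.

Definition section_one := section_of (subgroup1 sV).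
Definition section_mul u v := section_of (subgroupM sV (valV u) (valV v)).
Definition section_inv u := section_of (subgroupV sV (valV u)).

Lemma section_ofM x y (Vx : V x) (Vy : V y) (Vxy : V (x * y)) :
  section_mul (section_of Vx) (section_of Vy) = section_of Vxy.
Proof.
apply/section_of_eq; have [Vx' Qx] := coset_repP Vx; have [Vy' Qy] := coset_repP Vy.
rewrite /=; have -> : (coset_rep x * coset_rep y)^-1 * (x * y) =
  (y^-1 * coset_rep y)^-1 * ((x^-1 * coset_rep x)^-1) ^ y by gnormalize.
by apply: (subgroupM sQ); [exact: subgroupV|apply: QJ => //; exact: subgroupV].
Qed.

Lemma section_valK u : section_of (valV u) = u.
Proof. by apply: section_inj => /=; case: (section_valP u). Qed.

Lemma section_mulA : associative section_mul.
Proof.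
move=> u v w; rewrite -(section_valK u) -(section_valK v) -(section_valK w).
have Vvw := subgroupM sV (valV v) (valV w); have Vuv := subgroupM sV (valV u) (valV v).
rewrite (section_ofM _ _ Vvw) (section_ofM _ _ Vuv).
have Vuvw := subgroupM sV (valV u) Vvw; rewrite (section_ofM _ _ Vuvw).
have Vuvw' := subgroupM sV Vuv (valV w); rewrite (section_ofM _ _ Vuvw').
by apply/section_of_eq; rewrite -mulgA mulVg; exact: subgroup1.
Qed.

Lemma section_mul1g : left_id section_one section_mul.
Proof.
move=> u; rewrite -(section_valK u) (section_ofM _ _ (subgroupM sV (subgroup1 sV) (valV u))).
by apply/section_of_eq; rewrite mul1g mulVg; exact: subgroup1.
Qed.

Lemma section_mulVg : left_inverse section_one section_inv section_mul.
Proof.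
move=> u; rewrite -{2}(section_valK u) (section_ofM _ _ (subgroupM sV (subgroupV sV (valV u)) (valV u))).
by apply/section_of_eq; rewrite mulVg mulg1 invg1; exact: subgroup1.
Qed.

Lemma section_mulg1 : right_id section_one section_mul.
Proof.
move=> u; rewrite -(section_valK u) (section_ofM _ _ (subgroupM sV (valV u) (subgroup1 sV))).
by apply/section_of_eq; rewrite mulg1 mulVg; exact: subgroup1.
Qed.

Lemma section_mulgV : right_inverse section_one section_inv section_mul.
Proof.
move=> u; rewrite -{1}(section_valK u) (section_ofM _ _ (subgroupM sV (valV u) (subgroupV sV (valV u)))).
by apply/section_of_eq; rewrite mulgV mulg1 invg1; exact: subgroup1.
Qed.

Lemma exists_section_group : exists (K : groupType) (phi : G -> K),
  [/\ forall x y, V x -> V y -> phi (x * y) = phi x * phi y,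
      forall u, exists2 x, V x & phi x = u &
      forall x, V x -> phi x = 1 <-> Q x].
Proof.
pose K : groupType := HB.pack section_group
  (isGroup.Build section_group
     section_mulA section_mul1g section_mulg1 section_mulVg section_mulgV).
(* The map is total on [G], with default value 1 outside [V]. *)
exists K, (fun x => if pselect (V x) is left Vx then section_of Vx else section_one).
split=> [x y Vx Vy|u|x Vx].
- have Vxy := subgroupM sV Vx Vy.
  case: pselect => // Vxy'; case: pselect => // Vx'; case: pselect => // Vy'.
  by rewrite -(section_ofM Vx' Vy' Vxy').
- exists (section_val u) => //.
  by case: pselect => // Vu; apply: section_inj => /=; case: (section_valP u).
- case: pselect => // Vx'; rewrite -[1]/section_one -section_of_eq mulg1.
  by split=> [/(subgroupV sQ)|/(subgroupV sQ)//]; rewrite invgK.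
Qed.

End SectionGroup.

(** * Bounds depending only on n and k *)

(** [covered_gap] yields some [N] below a bound, not a definite one; this provides one constant for
    all of them. *)
Lemma uniform_bound (P : nat -> nat -> Prop) b :
  (forall N, exists M, P N M) -> (forall N M M', M <= M' -> P N M -> P N M') ->
  exists M, forall N, N <= b -> P N M.
Proof.
move=> exP monoP; elim: b => [|b [M PM]].
  by have [M PM] := exP 0; exists M => N; rewrite leqn0 => /eqP->.
have [M' PM'] := exP b.+1; exists (M + M') => N; rewrite leq_eqVlt.
case/predU1P => [->|Nb]; first exact: monoP (leq_addl _ _) PM'.
exact: monoP (leq_addr _ _) (PM _ Nb).
Qed.

Lemma metabelian_covered n k : 0 < n -> exists M, forall (G : groupType) (S : seq G),
  metabelian G -> size S <= k -> covered (Comm [set: G] [set: G]) n (1 :: S) ->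
  exists H : set G, [/\ is_subgroup H, index_le H M &
    classes_le (lower_central 4 H) eq M].
Proof.
(* The successor only makes the function positive at 0. *)
move=> n0; have [b bP] := @covered_gap (fun m => (m * m).+1) n k n0 (fun _ => isT).
pose P N M := forall G : groupType, metabelian G -> comm_gap G N k ->
  exists H : set G, [/\ is_subgroup H, index_le H M &
    classes_le (lower_central 4 H) eq M].
have [|N M M' MM' PM G mab gapG|M MP] := @uniform_bound P b.
- by move=> N; exact: metabelian_lower_central4.
- have [H [sH iH H4]] := PM G mab gapG; exists H; split=> //.
    exact: index_le_sub iH _ _.
  exact: classes_le_sub H4 _ _ _.
exists M => G S mab sS cov; have [m [S' [m0 mb sS' cov' gap]]] := bP _ _ _ sS cov.
apply: (MP m mb) => //; split; first by exists S'.
move=> x y sxy; apply: gap; first by exists x => //; exists y.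
exact: small_sub sxy.
Qed.

Lemma covered_section n k : 0 < n -> exists M, forall (G : groupType) (S : seq G),
  size S <= k -> covered (Comm [set: G] [set: G]) n (1 :: S) ->
  exists V Q : set G, [/\ is_subgroup V /\ index_le V M,
      is_subgroup Q /\ Q `<=` V,
      forall g c, V g -> Q c -> Q (c ^ g),
      classes_le Q eq M &
      forall x y z t, V x -> V y -> V z -> V t -> Q [~ [~ x, y], [~ z, t]]].
Proof.
move=> n0; have nn0 : 0 < n * n by rewrite muln_gt0 n0.
(* As [b1 * s * (b2 * t) = b1 * b2 ^ s^-1 * (s * t)], the products of two representatives, 1
   included, represent the elements of [comm2]. *)
pose k2 := (k.+1 * k.+1)%N.
have [b bP] := @covered_gap (fun m => (m ^ 8).+1) (n * n) k2 nn0 (fun _ => isT).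
have [|N M M' MM' PM|M MP] := @uniform_bound (fun N M => section_bound N k2 <= M) b.
- by move=> N; exists (section_bound N k2).
- exact: leq_trans MM'.
exists M => G S sS cov.
have cov2 : covered (@comm2 G) (n * n) (1 :: [seq s * t | s <- 1 :: S, t <- 1 :: S]).
  move=> _ [x [y [x' [y' ->]]]].
  have [|b1 [s [Bb sS1 e]]] := cov [~ x, y]; first by exists x => //; exists y.
  have [|b2 [t [Bb' tS1 e']]] := cov [~ x', y']; first by exists x' => //; exists y'.
  exists (b1 * b2 ^ s^-1), (s * t); split; first by apply: smallM => //; exact: smallJ.
    by rewrite inE; apply/orP; right; apply: allpairs_f.
  by rewrite e e'; gnormalize.
have [|N [S' [N0 Nb sS' covN gap']]] := bP _ _ _ _ cov2.
  by rewrite size_allpairs /= leq_mul.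
have gap (c : G) : comm2 c -> small (N ^ 8) c -> small N c.
  by move=> Cc Bc; apply: gap' => //; apply: small_sub Bc.
have /choice[f fP] : forall c, exists i : 'I_k2.+1, comm2 c ->
    exists2 b, small N b & c = b * nth 1 (1 :: S') i.
  move=> c; have [/covN[b1 [s [Bb sS1 e]]]|nc] := pselect (comm2 c); last first.
    by exists ord0.
  have li : index s (1 :: S') < k2.+1.
    by apply: leq_trans (_ : size (1 :: S') <= _); rewrite ?index_mem.
  by exists (Ordinal li) => _; exists b1 => //=; rewrite nth_index.
have fW c c' : comm2 c -> comm2 c' -> f c = f c' -> words (small N) 2 (c / c').
  move=> /fP[b1 Bb e] /fP[b2 Bb' e'] ecc; rewrite {1}e {1}e' ecc.
  have -> : b1 * nth 1 (1 :: S') (f c') / (b2 * nth 1 (1 :: S') (f c')) = b1 / b2.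
    by gnormalize.
  by apply: (@words_cat _ _ 1 1); apply: words1 => //; exact: smallV.
have gapG : comm_gap G N k2.
  split; first exists S' => //.
    by move=> _ [x _ [y _ <-]]; apply: covN; exact: comm2_comm.
  move=> x y Bxy; apply: gap; first exact: comm2_comm.
  by apply: small_sub Bxy; rewrite mulnn; apply: leq_pexp2l.
have [V [Q [[sV iV] [sQ QV] QJ cQ VQ]]] := exists_metabelian_section N0 gap fW gapG.
have sM := MP _ Nb; exists V, Q; split=> //.
  by split=> //; exact: index_le_sub iV _ sM.
exact: classes_le_sub cQ _ _ sM.
Qed.

(** * Lower central series and the way back from the section *)

Lemma commutator_subgroup_mono (G : groupType) (A A' B B' : set G) :
  A `<=` A' -> B `<=` B' -> commutator_subgroup A B `<=` commutator_subgroup A' B'.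
Proof.
move=> AA BB; apply: generated_sub; first exact: subgroup_generated.
move=> _ [x Ax [y By <-]]; apply: sub_generated.
by exists x; [exact: AA|exists y => //; exact: BB].
Qed.

Lemma lower_central_mono (G : groupType) (H K : set G) i :
  H `<=` K -> lower_central i H `<=` lower_central i K.
Proof.
move=> HK; rewrite /lower_central; elim: i.-1 => //= j IHj.
exact: commutator_subgroup_mono.
Qed.

Lemma lower_centralJ (G : groupType) (H : set G) i x h : is_subgroup H ->
  lower_central i H x -> H h -> lower_central i H (x ^ h).
Proof.
move=> sH + Hh; rewrite /lower_central; elim: i.-1 x => /= [|j IHj] x Hx.
  exact: (subgroupJ sH).
apply: generatedJ Hx => _ [y Hy [g Hg <-]]; rewrite conjRg.
by exists (y ^ h); [exact: IHj|exists (g ^ h) => //; exact: (subgroupJ sH)].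
Qed.

Lemma lower_central_sub (G : groupType) (H : set G) i : is_subgroup H ->
  lower_central i H `<=` H.
Proof.
move=> sH; rewrite /lower_central; elim: i.-1 => //= j IHj.
by apply: generated_sub => // _ [y /IHj Hy [g Hg <-]]; exact: (subgroupR sH).
Qed.

Section PullBack.
Variables (G K : groupType) (V Q : set G) (phi : G -> K).
Hypothesis sV : is_subgroup V.
Hypothesis phiM : forall x y, V x -> V y -> phi (x * y) = phi x * phi y.
Hypothesis phi_onto : forall u, exists2 x, V x & phi x = u.
Hypothesis phi_ker : forall x, V x -> phi x = 1 <-> Q x.
Implicit Types x y : G.

Let phi1 : phi 1 = 1.
Proof. by apply: (mulgI (phi 1)); rewrite -phiM ?mulg1 //; exact: subgroup1. Qed.

Let phiV x : V x -> phi x^-1 = (phi x)^-1.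
Proof.
move=> Vx; apply/esym/mulg1_eq; rewrite -phiM ?mulgV //; exact: subgroupV.
Qed.

Let phiJ x y : V x -> V y -> phi (x ^ y) = phi x ^ phi y.
Proof.
move=> Vx Vy; have Vy' := subgroupV sV Vy; have Vxy := subgroupM sV Vx Vy.
by rewrite /conjg !phiM // phiV.
Qed.

Let phiR x y : V x -> V y -> phi [~ x, y] = [~ phi x, phi y].
Proof.
move=> Vx Vy; have Vx' := subgroupV sV Vx; have Vxy := subgroupJ sV Vx Vy.
by rewrite /commg phiM // phiV // phiJ.
Qed.

Lemma small_image n x : V x -> small n x -> small n (phi x).
Proof.
move=> Vx [f fP]; have /choice[s sP] : forall u, exists y, V y /\ phi y = u.
  by move=> u; have [y] := phi_onto u; exists y.
exists (f \o s) => u v _ _ /(fP _ _ I I) /= e.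
have [Vu <-] := sP u; have [Vv <-] := sP v.
have Vv' := subgroupV sV Vv.
by rewrite -phiV // -phiM // -phiJ ?e //; exact: (subgroupM sV).
Qed.

(** A representative [s] need not lie in [V]; it is replaced by a commutator of elements of [V]
    represented by [s], and the quotient of two elements of [small n] squares [n]. *)
Lemma covered_image n S : covered (Comm [set: G] [set: G]) n S ->
  exists2 S' : seq K, size S' <= size S &
  covered (Comm [set: K] [set: K]) (n * n) S'.
Proof.
move=> cov.
have /choice[c cP] : forall s, exists c, forall x y b, V x -> V y ->
    small n b -> [~ x, y] = b * s -> V c /\ exists2 b', small n b' & c = b' * s.
  move=> s; have [[x [y [b [Vx Vy Bb e]]]]|ns] := pselect (exists x y b,
    [/\ V x, V y, small n b & [~ x, y] = b * s]).
    exists [~ x, y] => _ _ _ _ _ _ _; split; first exact: (subgroupR sV).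
    by exists b.
  by exists 1 => x y b Vx Vy Bb e; case: ns; exists x, y, b.
exists [seq phi (c s) | s <- S]; first by rewrite size_map.
move=> _ [u _ [v _ <-]]; have [x Vx <-] := phi_onto u; have [y Vy <-] := phi_onto v.
have [|b [s [Bb sS e]]] := cov [~ x, y]; first by exists x => //; exists y.
have [Vc [b' Bb' ec]] := cP s x y b Vx Vy Bb e.
have Vxy := subgroupR sV Vx Vy; have Vd := subgroupF sV Vxy Vc.
exists (phi ([~ x, y] / c s)), (phi (c s)); split.
- apply: small_image => //; rewrite e ec.
  have -> : b * s / (b' * s) = b / b' by gnormalize.
  by apply: smallM => //; exact: smallV.
- exact: map_f.
- by rewrite -phiM // mulgVK phiR.
Qed.

Lemma metabelian_image :
  (forall x y z t, V x -> V y -> V z -> V t -> Q [~ [~ x, y], [~ z, t]]) ->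
  metabelian K.
Proof.
move=> VQ u v w r; apply/commgP/eqP.
have [x Vx <-] := phi_onto u; have [y Vy <-] := phi_onto v.
have [z Vz <-] := phi_onto w; have [t Vt <-] := phi_onto r.
have Vxy := subgroupR sV Vx Vy; have Vzt := subgroupR sV Vz Vt.
rewrite -phiR // -phiR // -phiR //; apply/phi_ker; last exact: VQ.
exact: (subgroupR sV).
Qed.

Lemma pull_back_lower_central (H : set K) n m p :
  index_le V n -> classes_le Q eq m -> is_subgroup H -> index_le H p ->
  classes_le (lower_central 4 H) eq p ->
  exists H' : set G, [/\ is_subgroup H', index_le H' (n * p) &
    classes_le (lower_central 4 H') eq (p * m)].
Proof.
move=> iV [h hP] sH [f fP] [g gP]; pose H' := V `&` [set x | H (phi x)].
have sH' : is_subgroup H'.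
  apply: subgroup_intro => [|x y [Vx Hx] [Vy Hy]|x [Vx Hx]]; split=> /=.
  - exact: subgroup1.
  - by rewrite phi1; exact: subgroup1.
  - exact: (subgroupM sV).
  - by rewrite phiM //; exact: (subgroupM sH).
  - exact: (subgroupV sV).
  - by rewrite phiV //; exact: (subgroupV sH).
exists H'; split=> //.
  apply: (index_le_trans sV iV); exists (f \o phi) => x y Vx Vy /(fP _ _ I I) Hxy.
  split; first exact: (subgroupF sV).
  by rewrite /= phiM ?phiV //; exact: (subgroupV sV).
have phi4 x : lower_central 4 H' x -> lower_central 4 H (phi x).
  suff: forall i, lower_central i H' `<=` V `&` [set x | lower_central i H (phi x)].
    by move=> W /W[].
  move=> i; rewrite /lower_central; elim: i.-1 => [|j IHj] /=; first by move=> y [].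
  apply: generated_sub; last first.
    move=> _ [y /IHj[Vy Hy] [z [Vz Hz] <-]]; split; first exact: (subgroupR sV).
    by rewrite /= phiR //; apply: sub_generated; exists (phi y) => //; exists (phi z).
  have sL := @subgroup_generated K (Comm (iter j (fun L => commutator_subgroup L H) H) H).
  apply: subgroup_intro => [|y z [Vy Hy] [Vz Hz]|y [Vy Hy]]; split=> /=.
  - exact: subgroup1.
  - by rewrite phi1; exact: (subgroup1 sL).
  - exact: (subgroupM sV).
  - by rewrite phiM //; exact: (subgroupM sL).
  - exact: (subgroupV sV).
  - by rewrite phiV //; exact: (subgroupV sL).
have V4 x : lower_central 4 H' x -> V x by move=> /(lower_central_sub sH')[].
have /choice[s sP] : forall i : 'I_p, exists s, forall x,
    lower_central 4 H' x -> g (phi x) = i -> Q (s^-1 * x).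
  move=> i; have [[s [Hs si]]|ns] := pselect (exists s,
      lower_central 4 H' s /\ g (phi s) = i).
    exists s => x Hx xi; have Vs := subgroupV sV (V4 _ Hs).
    apply/phi_ker; first by apply: (subgroupM sV) => //; exact: V4.
    rewrite phiM ?phiV //; try exact: V4.
    have -> : phi x = phi s by apply: gP; [exact: phi4|exact: phi4|rewrite xi si].
    by rewrite mulVg.
  by exists 1 => x Hx xi; case: ns; exists x.
apply: (@classes_le_intro _ _ (fun x => (g (phi x), h ((s (g (phi x)))^-1 * x)))).
  by rewrite card_prod !card_ord.
move=> x y Hx Hy [e]; rewrite e => /hP E; apply: (mulgI (s (g (phi y)))^-1).
by apply: E; exact: sP.
Qed.

End PullBack.

(** [H'] is the centralizer in [H] of gamma_4(H), and its gamma_5 is trivial because its gamma_4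
    lies inside gamma_4(H). *)
Lemma centralize_lower_central (G : groupType) (H : set G) n m : is_subgroup H ->
  index_le H n -> classes_le (lower_central 4 H) eq m ->
  exists H' : set G, [/\ is_subgroup H', nilpotent_class_le 4 H',
    index_le H' (n * m ^ m) & classes_le (lower_central 4 H') eq m].
Proof.
move=> sH iH H4; pose H' := H `&` [set g | forall x, lower_central 4 H x -> x ^ g = x].
have sH' : is_subgroup H' by apply: subgroupI => //; exact: subgroup_cent.
have H'4 : lower_central 4 H' `<=` lower_central 4 H by apply: lower_central_mono => x [].
exists H'; split=> //.
- apply/seteqP; split; last by move=> _ ->; exact: (subgroup1 (@subgroup_generated _ _)).
  apply: generated_sub; last first.
    by move=> _ [x /H'4 Hx [y [_ cy] <-]] /=; rewrite commgEl cy // mulVg.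
  by apply: subgroup_intro => [//|x y -> ->|x ->]; rewrite ?mulg1 ?invg1.
- apply: (index_le_trans sH iH).
  have [|f fP] := index_le_cent_finite sH _ H4.
    by move=> x h Hx Hh; exact: lower_centralJ.
  by exists f => x y Hx Hy /fP c; split; [exact: (subgroupF sH)|exact: c].
- exact: classes_le_sub H4 H'4 _ _.
Qed.

Lemma covered_of_comm_covering (G : groupType) n k (S : set G) : S #= `I_k ->
  comm_covering n S -> exists2 R : seq G, size R <= k &
  covered (Comm [set: G] [set: G]) n (1 :: R).
Proof.
move=> /card_eqPle[Sk _] cov.
have S0 : S !=set0.
  by have [|b _ [s Ss _]] := cov [~ 1, 1]; [exists 1 => //; exists 1|exists s].
have [f fP] := card_le_classes_le S0 Sk.
have /choice[r rP] : forall i, exists r, forall s, S s -> f s = i -> s = r.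
  move=> i; have [[r [Sr ri]]|nr] := pselect (exists r, S r /\ f r = i).
    by exists r => s Ss si; apply: fP; rewrite // si ri.
  by exists 1 => s Ss si; case: nr; exists s.
exists [seq r i | i <- enum 'I_k]; first by rewrite size_map size_enum_ord.
move=> c /cov[b Bb [s Ss <-]]; exists b, s; split=> //.
  exact: small_classes_small.
rewrite inE; apply/orP; right; rewrite (rP _ s Ss erefl).
by apply: map_f; rewrite mem_enum.
Qed.

Lemma right_cosets_card_le (G : groupType) (H : set G) n : is_subgroup H ->
  index_le H n -> right_cosets H #<= `I_n.
Proof.
move=> sH iH; apply: classes_le_card_le; apply: (classes_le_image 1).
apply: classes_le_sub iH _ _ _ => // x y _ _ Hxy.
apply/seteqP; split=> _ [h Hh <-].
  by exists (h * (x / y)); [exact: (subgroupM sH)|gnormalize].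
by exists (h / (x / y)); [exact: (subgroupF sH)|gnormalize].
Qed.

Theorem theorem1p2 :
  forall n k : nat, (0 < n)%N -> (0 < k)%N ->
  exists M : nat,
    forall (G : groupType) (S : set G),
      S `<=` commutator_subgroup [set: G] [set: G] ->
      S #= `I_k ->
      comm_covering n S ->
      exists H : set G,
        [/\ is_subgroup H,
            nilpotent_class_le 4 H,
            right_cosets H #<= `I_M &
            lower_central 4 H #<= `I_M].
Proof.
move=> n k n0 _; have nn0 : 0 < n * n by rewrite muln_gt0 n0.
(* [covered_image] squares [n], and the representatives in the section come from the list [1 :: R],
   hence [k.+1]. *)
have [m mP] := covered_section k n0; have [p pP] := metabelian_covered k.+1 nn0.
exists (m * p * (p * m) ^ (p * m) + p * m)%N => G S _ Sk cov.
have [R sR covR] := covered_of_comm_covering Sk cov.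
have [V [Q [[sV iV] [sQ QV] QJ cQ VQ]]] := mP G R sR covR.
have [K [phi [phiM phi_onto phi_ker]]] := exists_section_group sV sQ QJ.
have [S' sS' covS'] := covered_image sV phiM phi_onto covR.
have mabK := metabelian_image sV phiM phi_onto phi_ker VQ.
have [||H0 [sH0 iH0 cH0]] := pP K S' mabK.
- by apply: leq_trans sS' _.
- move=> c /covS'[b [s [Bb sS e]]]; exists b, s; split=> //.
  by rewrite inE sS orbT.
have [H1 [sH1 iH1 cH1]] := pull_back_lower_central sV phiM phi_ker iV cQ sH0 iH0 cH0.
have [H [sH nH iH cH]] := centralize_lower_central sH1 iH1 cH1.
exists H; split=> //.
  apply: right_cosets_card_le => //.
  by apply: index_le_sub iH _ _ => //; exact: leq_addr.
by apply: classes_le_card_le; apply: classes_le_sub cH _ _ _ => //; exact: leq_addl.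
Qed.
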